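(* Let $d\ge 3$, $n\ge 2(d+1)$ (with $dn$ an integer), and $f\in C(\mathbb{S}^d)$. Let $r>0$ and suppose there is $\delta>0$ (independent of $\mathbf{x}$) such that $$\|f\|_{W_{d;r}}:=\sup_{\mathbf{x}\in\mathbb{S}^d}\left(\|f\|_\infty+\min_{P\in\Pi_r^d}\max_{\mathbf{y}\in\mathbb{B}(\mathbf{x},\delta)}\frac{|f(\mathbf{y})-P(\mathbf{y})|}{|\mathbf{x}-\mathbf{y}|_{d+1}^r}\right)<\infty.$$ If $dn\ge(d+r+1)^2$ and $\sqrt{16r\log n/n}\le\delta$, then $$E_{d;2(d+2)n}(f)\lesssim\frac{d^{1/6}}{\mathsf{dim}(\Pi_{2(d+2)n}^d)^{r/d}}\|f\|_{W_{d;r}}.$$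
   Context: $\mathbb{S}^d$ is the unit sphere of $\mathbb{R}^{d+1}$, $|\cdot|_{d+1}$ the Euclidean norm, $\mathbb{B}(\mathbf{x},\delta)=\{\mathbf{y}\in\mathbb{S}^d:|\mathbf{x}-\mathbf{y}|_{d+1}\le\delta\}$. For real $m>0$, $\Pi_m^d$ is the space of restrictions to $\mathbb{S}^d$ of algebraic polynomials in $d+1$ variables of total degree $<m$. $\|g\|_\infty=\sup_{\mathbb{S}^d}|g|$ and $E_{d;m}(f)=\min_{P\in\Pi_m^d}\|f-P\|_\infty$. Convention: $A\lesssim B$ means $A\le cB$ for a positive constant $c$ that may depend on $r$ but is independent of $d$, $n$, $f$. *)

(* Defs.v *)
From HB Require Import structures.
From mathcomp Require Import all_boot all_order all_algebra.
From mathcomp Require Import all_classical all_reals all_analysis.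
Unset Strict Implicit. Unset Printing Implicit Defensive.
Import Order.TTheory GRing.Theory Num.Theory.
Import numFieldNormedType.Exports.
Local Open Scope classical_set_scope.
Local Open Scope ring_scope.

Section Defs.
Context {R : realType}.

Definition enorm {d : nat} (v : 'rV[R]_(d.+1)) : R :=
  Num.sqrt (\sum_(i < d.+1) v ord0 i ^+ 2).

Definition sphere (d : nat) : set 'rV[R]_(d.+1) := [set x | enorm x = 1].

Definition sball (d : nat) (x : 'rV[R]_(d.+1)) (delta : R) : set 'rV[R]_(d.+1) :=
  [set y | sphere d y /\ enorm (x - y) <= delta].

Definition monomial {d : nat} (a : 'I_(d.+1) -> nat) (x : 'rV[R]_(d.+1)) : R :=
  \prod_(i < d.+1) x ord0 i ^+ a i.
Definition mdeg {d : nat} (a : 'I_(d.+1) -> nat) : nat := (\sum_(i < d.+1) a i)%N.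

(* P is (the function of) an algebraic polynomial in d+1 variables of total
   degree < m (m real); Pi_m^d consists of the restrictions of these to S^d *)
Definition polyfun (d : nat) (m : R) (P : 'rV[R]_(d.+1) -> R) : Prop :=
  exists s : seq (R * ('I_(d.+1) -> nat)),
    all (fun t => (mdeg t.2)%:R < m) s /\
    forall x, P x = \sum_(t <- s) t.1 * monomial t.2 x.

Definition supnorm {d : nat} (g : 'rV[R]_(d.+1) -> R) : \bar R :=
  ereal_sup [set (`|g x|)%:E | x in sphere d].

Definition Ebest {d : nat} (m : R) (f : 'rV[R]_(d.+1) -> R) : \bar R :=
  ereal_inf [set supnorm (fun x => f x - P x) | P in polyfun d m].

(* local term: min_{P in Pi_r} max_{y in B(x,delta)} |f y - P y| / |x - y|^r
   (the point y = x, where the ratio is 0/0, is excluded) *)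
Definition loc_err {d : nat} (r delta : R) (f : 'rV[R]_(d.+1) -> R)
    (x : 'rV[R]_(d.+1)) : \bar R :=
  ereal_inf [set ereal_sup [set (`|f y - P y| / enorm (x - y) `^ r)%:E
                           | y in sball d x delta `\ x]
            | P in polyfun d r].

Definition Wnorm {d : nat} (r delta : R) (f : 'rV[R]_(d.+1) -> R) : \bar R :=
  ereal_sup [set (supnorm f + loc_err r delta f x)%E | x in sphere d].

Definition indep_on_sphere {d k : nat} (ps : 'I_k -> 'rV[R]_(d.+1) -> R) : Prop :=
  forall c : 'I_k -> R,
    (forall x, sphere d x -> \sum_(i < k) c i * ps i x = 0) -> forall i, c i = 0.

Definition dim_Pi (d : nat) (m : R) (k : nat) : Prop :=
  (exists ps : 'I_k -> 'rV[R]_(d.+1) -> R,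
      (forall i, polyfun d m (ps i)) /\ indep_on_sphere ps) /\
  ~ (exists ps : 'I_k.+1 -> 'rV[R]_(d.+1) -> R,
      (forall i, polyfun d m (ps i)) /\ indep_on_sphere ps).

End Defs.

(* Main.v *)
(* A linear operator Q does the job, with an error O_r(n^-r) whose constant does
   not involve the factor d^(1/6).  Write K_N for the reproducing kernel of the
   polynomials of degree at most N on the sphere; K_N(x,x) is the constant
   dim V_N.  With M = dn and N = M + T, T about n, the kernel

     Phi(x,y) = K_N(x,y) (K_M(x,y) / dim V_M) u(x.y)

   reproduces P at x whenever u P has degree at most T and u(1) = 1.  Since K_N
   and K_M have square integrals dim V_N and dim V_M, the integral of
   |K_N K_M| / dim V_M is at most (dim V_N / dim V_M + 1) / 2, which is bounded
   because (1 + T/M)^d is.  So all the localisation can be left to a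
   one-variable polynomial u of degree about n, a power of a Dirichlet kernel:
   |u| <= 1 and |u| <= (c / (n|x-y|))^s.  This beats |x-y|^r near x and, beyond
   distance delta >= c n^(-1/2), the growth of the local polynomial P, which is
   controlled along great circles.

   The surface measure is replaced by a finite positive measure on the sphere
   whose moments up to degree 2N are invariant under reflections: the minimiser
   of the energy sum_ij w_i w_j (1 + y_i.y_j)^(2N), whose moments are unique by
   strict convexity. *)
Require Import Defs.
From HB Require Import structures.
From mathcomp Require Import all_boot all_order all_algebra.
From mathcomp Require Import all_classical all_reals all_analysis.
From mathcomp Require Import ring lra zify.
Import Order.TTheory GRing.Theory Num.Theory.
Import numFieldNormedType.Exports.
Local Open Scope classical_set_scope.
Local Open Scope ring_scope.
Set Implicit Arguments.
Unset Strict Implicit.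
Unset Printing Implicit Defensive.

(** * Inner product, unit sphere and hyperplane reflections *)

Section DotProduct.
Context {R : realType} {d : nat}.
Local Notation X := 'rV[R]_(d.+1).
Implicit Types (x y v : X).

Definition dot x y : R := \sum_(i < d.+1) x ord0 i * y ord0 i.

Lemma dotC x y : dot x y = dot y x.
Proof. by apply: eq_bigr => i _; rewrite mulrC. Qed.

Lemma dotDl x y v : dot (x + y) v = dot x v + dot y v.
Proof. by rewrite -big_split; apply: eq_bigr => i _; rewrite mxE mulrDl. Qed.

Lemma dotZl a x y : dot (a *: x) y = a * dot x y.
Proof. by rewrite mulr_sumr; apply: eq_bigr => i _; rewrite mxE mulrA. Qed.

Lemma dotDr x y v : dot v (x + y) = dot v x + dot v y.
Proof. by rewrite dotC dotDl !(dotC v). Qed.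

Lemma dotZr a x y : dot x (a *: y) = a * dot x y.
Proof. by rewrite dotC dotZl dotC. Qed.

Lemma dotNl x y : dot (- x) y = - dot x y.
Proof. by rewrite -scaleN1r dotZl mulN1r. Qed.

Lemma dotNr x y : dot x (- y) = - dot x y.
Proof. by rewrite dotC dotNl dotC. Qed.

Lemma dot_ge0 x : 0 <= dot x x.
Proof. by apply: sumr_ge0 => i _; rewrite -expr2 sqr_ge0. Qed.

Lemma dot_eq0 x : dot x x = 0 -> x = 0.
Proof.
move=> h; apply/rowP => i; rewrite mxE; apply/eqP.
rewrite -sqrf_eq0 expr2; apply/eqP.
have /psumr_eq0P : \sum_(j < d.+1) x ord0 j * x ord0 j = 0 by [].
by apply => // j _; rewrite -expr2 sqr_ge0.
Qed.

Lemma enormE x : enorm x = Num.sqrt (dot x x).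
Proof. by congr Num.sqrt; apply: eq_bigr => i _; rewrite expr2. Qed.

Lemma enorm_ge0 x : 0 <= enorm x.
Proof. by rewrite enormE sqrtr_ge0. Qed.

Lemma enorm_sqr x : enorm x ^+ 2 = dot x x.
Proof. by rewrite enormE sqr_sqrtr ?dot_ge0. Qed.

Lemma sphereP x : sphere d x <-> dot x x = 1.
Proof.
rewrite /sphere /=; split=> h; first by rewrite -enorm_sqr h expr1n.
by rewrite enormE h sqrtr1.
Qed.

Lemma enormB_sqr x y : sphere d x -> sphere d y ->
  enorm (x - y) ^+ 2 = 2 - 2 * dot x y.
Proof.
move=> /sphereP hx /sphereP hy.
rewrite enorm_sqr dotDl !dotDr !dotNl !dotNr hx hy (dotC y x); ring.
Qed.

Lemma enorm_eq0 x y : enorm (x - y) = 0 -> x = y.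
Proof.
move=> h; apply/eqP; rewrite -subr_eq0; apply/eqP/dot_eq0.
by rewrite -enorm_sqr h expr0n.
Qed.

Lemma dot_le1 x y : sphere d x -> sphere d y -> dot x y <= 1.
Proof.
move=> hx hy; have := sqr_ge0 (enorm (x - y)).
by rewrite enormB_sqr //; lra.
Qed.

Lemma dot_geN1 x y : sphere d x -> sphere d y -> -1 <= dot x y.
Proof.
move=> /[dup] hx /sphereP xx /[dup] hy /sphereP yy.
have := dot_ge0 (x + y); rewrite dotDl !dotDr xx yy (dotC y x); lra.
Qed.

Lemma coord_sphere_le1 x i : sphere d x -> `|x ord0 i| <= 1.
Proof.
move=> /sphereP hx; rewrite -(@ler_sqr _ `|_|) ?nnegrE // expr1n real_normK ?num_real //.
rewrite -hx /dot (bigD1 i) //= -expr2 lerDl.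
by apply: sumr_ge0 => j _; rewrite -expr2 sqr_ge0.
Qed.

(* Householder reflection; for [v = 0] the division makes it the identity. *)
Definition refl v x : X := x - (2 * dot x v / dot v v) *: v.

Lemma dot_refl v x y : dot (refl v x) (refl v y) = dot x y.
Proof.
rewrite /refl dotDl !dotDr !dotNl !dotNr !dotZl !dotZr (dotC v y).
have [v0|v0] := eqVneq (dot v v) 0.
  by rewrite v0 invr0; ring.
by field.
Qed.

Lemma refl_sphere v x : sphere d x -> sphere d (refl v x).
Proof. by move=> /sphereP h; apply/sphereP; rewrite dot_refl. Qed.

Lemma reflK v : involutive (refl v).
Proof.
move=> x; rewrite /refl dotDl dotNl dotZl.
have [v0|v0] := eqVneq (dot v v) 0.
  by rewrite v0 invr0 !mulr0 !scale0r !subr0.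
rewrite -addrA -opprD -scalerDl.
suff -> : 2 * dot x v / dot v v
   + 2 * (dot x v - 2 * dot x v / dot v v * dot v v) / dot v v = 0.
  by rewrite scale0r subr0.
by field.
Qed.

(** Unit vectors satisfy [2 x.(x - y) = |x - y|^2]. Reflections thus act transitively on the sphere;
    they are the only isometries used below. *)
Lemma refl_swap x y : sphere d x -> sphere d y -> refl (x - y) x = y.
Proof.
move=> hx hy; have [->|xy] := eqVneq x y.
  by rewrite /refl subrr scaler0 subr0.
have n0 : dot (x - y) (x - y) != 0.
  by apply: contra_neq xy => /dot_eq0/eqP; rewrite subr_eq0 => /eqP.
suff e : 2 * dot x (x - y) / dot (x - y) (x - y) = 1.
  by rewrite /refl e scale1r opprB addrC subrK.
apply/eqP; rewrite -(inj_eq (mulIf n0)) mul1r divfK //; apply/eqP.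
rewrite -enorm_sqr enormB_sqr // dotDr dotNr.
by move/sphereP: hx => ->; ring.
Qed.

End DotProduct.

(** * Polynomial functions graded by an integer degree bound *)

Section PolynomialFunctions.
Context {R : realType} {d : nat}.
Local Notation X := 'rV[R]_(d.+1).

Definition poly_le (N : nat) (p : X -> R) : Prop :=
  exists s : seq (R * ('I_(d.+1) -> nat)),
    all (fun t => mdeg t.2 <= N)%N s /\
    forall x, p x = \sum_(t <- s) t.1 * monomial t.2 x.

Lemma poly_le_of_polyfun (m : R) N p : m <= N.+1%:R -> polyfun d m p -> poly_le N p.
Proof.
move=> mN [s [/allP hs hp]]; exists s; split => //; apply/allP => t /hs h.
by rewrite -ltnS -(ltr_nat R); apply: lt_le_trans mN.
Qed.

Lemma polyfun_of_poly_le (m : R) N p : N%:R < m -> poly_le N p -> polyfun d m p.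
Proof.
move=> mN [s [/allP hs hp]]; exists s; split => //; apply/allP => t /hs h.
by apply: le_lt_trans mN; rewrite ler_nat.
Qed.

Lemma poly_leW M N p : (M <= N)%N -> poly_le M p -> poly_le N p.
Proof.
move=> mN [s [/allP hs hp]]; exists s; split => //; apply/allP => t /hs h.
exact: leq_trans mN.
Qed.

Lemma poly_le_ext N p q : p =1 q -> poly_le N p -> poly_le N q.
Proof. by move=> e [s [h1 h2]]; exists s; split => // x; rewrite -e. Qed.

Lemma poly_le_monomial N a : (mdeg a <= N)%N -> poly_le N (@monomial R d a).
Proof.
by exists [:: (1, a)]; split=> [|x]; rewrite /= ?andbT // big_seq1 mul1r.
Qed.

Lemma poly_leD N p q : poly_le N p -> poly_le N q -> poly_le N (fun x => p x + q x).
Proof.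
move=> [s [hs ps]] [t [ht pt]]; exists (s ++ t); split.
  by rewrite all_cat hs ht.
by move=> x; rewrite big_cat /= ps pt.
Qed.

Lemma poly_leZ N c p : poly_le N p -> poly_le N (fun x => c * p x).
Proof.
move=> [s [hs ps]]; exists [seq (c * t.1, t.2) | t <- s]; split.
  by rewrite all_map; apply: sub_all hs.
move=> x; rewrite big_map ps mulr_sumr; apply: eq_bigr => t _ /=.
by rewrite mulrA.
Qed.

Lemma poly_le_cst N c : poly_le N (fun _ => c).
Proof.
apply: (@poly_le_ext _ (fun x => c * monomial (fun=> 0%N) x)).
  by move=> x; rewrite /monomial big1 ?mulr1 // => i _; rewrite expr0.
by apply/poly_leZ/poly_le_monomial; rewrite /mdeg big1.
Qed.

Lemma poly_leN N p : poly_le N p -> poly_le N (fun x => - p x).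
Proof.
by move=> h; apply: poly_le_ext (poly_leZ (-1) h) => x; rewrite mulN1r.
Qed.

Lemma poly_le_sum (I : Type) (r : seq I) N (F : I -> X -> R) :
  (forall i, poly_le N (F i)) -> poly_le N (fun x => \sum_(i <- r) F i x).
Proof.
move=> h; elim: r => [|i r IH].
  by apply: poly_le_ext (poly_le_cst N 0) => x; rewrite big_nil.
by apply: poly_le_ext (poly_leD (h i) IH) => x; rewrite big_cons.
Qed.

Lemma monomialD a b (x : X) :
  monomial (fun i => (a i + b i)%N) x = monomial a x * monomial b x.
Proof.
by rewrite /monomial -big_split; apply: eq_bigr => i _; rewrite exprD.
Qed.

Lemma poly_leM M N p q :
  poly_le M p -> poly_le N q -> poly_le (M + N) (fun x => p x * q x).
Proof.
move=> [s [/allP hs ps]] [t [/allP ht pt]].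
exists [seq (u.1 * v.1, fun i => (u.2 i + v.2 i)%N) | u <- s, v <- t]; split.
  apply/all_allpairsP => u v us vt; rewrite /mdeg big_split /=.
  by rewrite leq_add //; [exact: hs|exact: ht].
move=> x; rewrite big_allpairs_dep /= ps pt mulr_suml; apply: eq_bigr => u _.
rewrite mulr_sumr; apply: eq_bigr => v _ /=; rewrite monomialD; ring.
Qed.

Lemma poly_leX N k p : poly_le N p -> poly_le (k * N) (fun x => p x ^+ k).
Proof.
move=> h; elim: k => [|k IH]; first exact: poly_le_ext (poly_le_cst _ 1).
rewrite mulSn; apply: poly_le_ext (poly_leM h IH) => x.
by rewrite exprS.
Qed.

Lemma poly_le_coord i : poly_le 1 (fun x : X => x ord0 i).
Proof.
apply: (@poly_le_ext _ (monomial (fun j => nat_of_bool (j == i)))).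
  move=> x; rewrite /monomial (bigD1 i) //= eqxx expr1 big1 ?mulr1 // => j.
  by move=> /negbTE ->; rewrite expr0.
apply: poly_le_monomial; rewrite /mdeg (bigD1 i) //= eqxx big1 // => j.
by move=> /negbTE ->.
Qed.

Lemma poly_le_dot (y : X) : poly_le 1 (fun x => dot x y).
Proof.
apply: poly_le_sum => i; apply: poly_le_ext (poly_leZ (y ord0 i) (poly_le_coord i)).
by move=> x; rewrite mulrC.
Qed.

Lemma poly_le_prod (I : Type) (r : seq I) (e : I -> nat) (F : I -> X -> R) :
  (forall i, poly_le (e i) (F i)) ->
  poly_le (\sum_(i <- r) e i) (fun x => \prod_(i <- r) F i x).
Proof.
move=> h; elim: r => [|i r IH].
  by apply: poly_le_ext (poly_le_cst _ 1) => x; rewrite big_nil.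
rewrite big_cons; apply: poly_le_ext (poly_leM (h i) IH) => x.
by rewrite big_cons.
Qed.

Lemma poly_le_comp N p (L : X -> X) :
  (forall i, poly_le 1 (fun x => L x ord0 i)) -> poly_le N p ->
  poly_le N (fun x => p (L x)).
Proof.
move=> hL [s [hs ps]].
apply: (@poly_le_ext _ (fun x => \sum_(t <- s) t.1 * monomial t.2 (L x))).
  by move=> x; rewrite ps.
elim: s hs {p ps} => [_|t s IH /= /andP[ht hs]].
  by apply: poly_le_ext (poly_le_cst _ 0) => x; rewrite big_nil.
have h1 : poly_le N (fun x => monomial t.2 (L x)).
  apply: poly_leW ht _; rewrite /mdeg; apply: poly_le_prod => i.
  by rewrite -[X in poly_le X]muln1; apply: poly_leX.
apply: poly_le_ext (poly_leD (poly_leZ t.1 h1) (IH hs)) => x.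
by rewrite big_cons.
Qed.

Lemma poly_le_refl N p (v : X) : poly_le N p -> poly_le N (fun x => p (refl v x)).
Proof.
apply: poly_le_comp => i.
have h := poly_leZ (- (2 / dot v v * v ord0 i)) (poly_le_dot v).
apply: poly_le_ext (poly_leD (poly_le_coord i) h) => x.
by rewrite !mxE; ring.
Qed.

End PolynomialFunctions.

(** * Linear dependence, Caratheodory reduction and spans *)

Section LinearAlgebra.
Context {R : realType}.

Lemma left_kernel_neq0 m n (A : 'M[R]_(m, n)) : (n < m)%N ->
  exists2 v : 'rV[R]_m, v != 0 & v *m A = 0.
Proof.
move=> nm; have /rowV0Pn[v vA v0] : kermx A != 0.
  rewrite -mxrank_eq0 mxrank_ker -lt0n subn_gt0.
  exact: leq_ltn_trans (rank_leq_col A) nm.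
by exists v => //; apply/sub_kermxP.
Qed.

Lemma linear_dependence (J : finType) k (c : 'I_k -> J -> R) : (#|J| < k)%N ->
  exists2 v : 'I_k -> R, exists i, v i != 0 & forall j, \sum_i v i * c i j = 0.
Proof.
move=> Jk; pose A : 'M[R]_(k, #|J|) := \matrix_(i, j) c i (enum_val j).
have [v v0 vA] := left_kernel_neq0 A Jk.
exists (v ord0); first by apply/rV0Pn.
move=> j; have /rowP/(_ (enum_rank j)) := vA; rewrite !mxE => e.
rewrite -[RHS]e; apply: eq_bigr => i _; by rewrite mxE enum_rankK.
Qed.

(** With more nodes than test functions, some nonzero [v] has all its sums equal to 0. Subtracting
    the multiple [t v] at which the first weight vanishes leaves the sums of [w] unchanged and frees
    one node. *)
Lemma conic_caratheodory_step (J : finType) (X : Type) (phi : J -> X -> R) k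
    (w : 'I_k.+1 -> R) (y : 'I_k.+1 -> X) :
  (forall i, 0 <= w i) -> (#|J| < k.+1)%N ->
  exists (i0 : 'I_k.+1) (w' : 'I_k -> R), (forall i, 0 <= w' i) /\
    forall j, \sum_i w' i * phi j (y (lift i0 i)) = \sum_i w i * phi j (y i).
Proof.
move=> w0 Jk; have [v [i1 vi1] vphi] := linear_dependence (fun i j => phi j (y i)) Jk.
wlog {vi1} vi1 : v vphi / 0 < v i1.
  move=> H; have [vp|vn] := ltP 0 (v i1); first exact: (H v).
  apply: (H (fun i => - v i)); last by rewrite oppr_gt0 lt_neqAle vi1.
  by move=> j; rewrite (eq_bigr (fun i => - (v i * phi j (y i)))) => [|i _]; rewrite ?mulNr // sumrN vphi oppr0.
case: (@Order.TotalTheory.arg_minP _ _ _ i1 (fun i => 0 < v i) (fun i => w i / v i)) => // i0 vi0 hmin.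
pose t := w i0 / v i0.
exists i0, (fun i => w (lift i0 i) - t * v (lift i0 i)); split.
  move=> i; rewrite subr_ge0; set l := lift i0 i.
  have [vl|vl] := ltP 0 (v l); first by rewrite -ler_pdivlMr //; exact: hmin.
  apply: le_trans (w0 l); rewrite mulr_ge0_le0 //.
  by rewrite /t divr_ge0 // ltW.
move=> j; have -> : \sum_i w i * phi j (y i) = \sum_i (w i - t * v i) * phi j (y i).
  under [RHS]eq_bigr do rewrite mulrBl -mulrA.
  by rewrite sumrB -mulr_sumr vphi mulr0 subr0.
rewrite (bigD1_ord i0) //= /t divfK ?gt_eqF // subrr mul0r add0r.
by [].
Qed.

(** The output has exactly [#|J|] nodes, so that it can compete with a minimiser taken among weights
    on that many nodes. *)
Lemma conic_caratheodory (J : finType) (X : Type) (S : X -> Prop)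
    (phi : J -> X -> R) k (w : 'I_k -> R) (y : 'I_k -> X) :
  (0 < k)%N -> (0 < #|J|)%N -> (forall i, 0 <= w i) -> (forall i, S (y i)) ->
  exists (w' : 'I_#|J| -> R) (y' : 'I_#|J| -> X),
    [/\ forall i, 0 <= w' i, forall i, S (y' i) &
    forall j, \sum_i w' i * phi j (y' i) = \sum_i w i * phi j (y i)].
Proof.
move=> k0 J0; elim: k k0 w y => // k IH _ w y w0 Sy.
have [kJ|Jk] := leqP k.+1 #|J|; last first.
  have [i0 [w' [w'0 e]]] := conic_caratheodory_step phi y w0 Jk.
  have k0 : (0 < k)%N by exact: leq_trans J0 _.
  have [w2 [y2 [h1 h2 h3]]] := IH k0 w' (fun i => y (lift i0 i)) w'0 (fun i => Sy _).
  by exists w2, y2; split => // j; rewrite h3 e.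
(* With at most [#|J|] nodes, the list is padded by weight 0 at a node already present. *)
pose f (T : Type) (a : T) (g : 'I_k.+1 -> T) (i : 'I_#|J|) :=
  if insub (val i) is Some i' then g i' else a.
exists (f _ 0 w), (f _ (y ord0) y); split.
- by move=> i; rewrite /f; case: insubP.
- by move=> i; rewrite /f; case: insubP.
move=> j; rewrite (bigID (fun i : 'I_#|J| => (i < k.+1)%N)) /= [X in _ + X]big1 ?addr0.
  pose g i := oapp (fun i : 'I_k.+1 => w i * phi j (y i)) 0 (insub i).
  transitivity (\sum_(i < k.+1) g i); last by apply: eq_bigr => i _; rewrite /g valK.
  rewrite (big_ord_widen _ g kJ) /f /g; apply: eq_bigr => i ik.
  by case: insubP => [i' _ _ //|]; rewrite ik.
by move=> i ik; rewrite /f insubN // mul0r.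
Qed.

Context {d : nat}.
Local Notation X := 'rV[R]_(d.+1).

Definition in_span (J : finType) (F : J -> X -> R) (p : X -> R) : Prop :=
  exists c : J -> R, forall x, sphere d x -> p x = \sum_j c j * F j x.

Lemma indep_le_span (J : finType) (F : J -> X -> R) k (ps : 'I_k -> X -> R) :
  indep_on_sphere ps -> (forall i, in_span F (ps i)) -> (k <= #|J|)%N.
Proof.
move=> hi /choice[c hc]; rewrite leqNgt; apply/negP => Jk.
have [v [i vi] vc] := linear_dependence c Jk.
case/negP: vi; apply/eqP; move: i; apply: hi => x xS.
under eq_bigr => i _ do rewrite hc // mulr_sumr.
rewrite exchange_big big1 //= => j _.
by under eq_bigr do rewrite mulrA; rewrite -mulr_suml vc mul0r.
Qed.

Lemma in_span_ext (J : finType) (F : J -> X -> R) p q :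
  (forall x, sphere d x -> p x = q x) -> in_span F p -> in_span F q.
Proof. by move=> e [c h]; exists c => x xS; rewrite -e ?h. Qed.

Lemma in_span_gen (J : finType) (F : J -> X -> R) j : in_span F (F j).
Proof.
exists (fun i => (i == j)%:R) => x _; rewrite (bigD1 j) //= eqxx mul1r big1 ?addr0 //.
by move=> i /negbTE ->; rewrite mul0r.
Qed.

Lemma in_spanD (J : finType) (F : J -> X -> R) p q :
  in_span F p -> in_span F q -> in_span F (fun x => p x + q x).
Proof.
move=> [c hc] [e he]; exists (fun j => c j + e j) => x xS.
by rewrite hc // he // -big_split; apply: eq_bigr => j _; rewrite mulrDl.
Qed.

Lemma in_spanZ (J : finType) (F : J -> X -> R) a p :
  in_span F p -> in_span F (fun x => a * p x).
Proof.
move=> [c hc]; exists (fun j => a * c j) => x xS.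
by rewrite hc // mulr_sumr; apply: eq_bigr => j _; rewrite mulrA.
Qed.

End LinearAlgebra.

(** * Coordinates of the [D]-th tensor power of [(1, x)] *)

Section Features.
Context {R : realType} {d : nat}.
Local Notation X := 'rV[R]_(d.+1).
Implicit Types (x y v : X).

(** Coordinate [i] of [(1, x)]; the entry 1 at index 0 lets products of exactly [D] coordinates
    reach all monomials of degree at most [D]. *)
Definition hcoord x (i : 'I_d.+2) : R := oapp (x ord0) 1 (unlift ord0 i).

Definition feature D (t : {ffun 'I_D -> 'I_d.+2}) x : R :=
  \prod_(j < D) hcoord x (t j).

Lemma sum_feature D x y :
  \sum_(t : {ffun 'I_D -> 'I_d.+2}) feature t x * feature t y = (1 + dot x y) ^+ D.
Proof.
under eq_bigr do rewrite -big_split /=.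
rewrite -(bigA_distr_bigA (fun (_ : 'I_D) i => hcoord x i * hcoord y i)) /=.
rewrite prodr_const card_ord; congr (_ ^+ _).
rewrite big_ord_recl /hcoord !unlift_none /= mulr1; congr (_ + _).
by apply: eq_bigr => i _; rewrite liftK.
Qed.

Lemma monomial_hcoord (a : 'I_d.+1 -> nat) :
  exists s : seq 'I_d.+2, size s = mdeg a /\
    forall x, monomial a x = \prod_(l <- s) hcoord x l.
Proof.
rewrite /mdeg /monomial; elim: (index_enum _) => [|i r [s [sz hs]]].
  by exists [::]; rewrite big_nil; split => // x; rewrite !big_nil.
exists (nseq (a i) (lift ord0 i) ++ s); split.
  by rewrite big_cons size_cat size_nseq sz.
move=> x; rewrite big_cons big_cat /= hs; congr (_ * _).
by rewrite big_nseq -Monoid.iteropE -[RHS]/(_ ^+ _) /hcoord liftK.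
Qed.

Lemma monomial_feature D (a : 'I_d.+1 -> nat) : (mdeg a <= D)%N ->
  exists t : {ffun 'I_D -> 'I_d.+2}, forall x, monomial a x = feature t x.
Proof.
have [s [sz hs]] := monomial_hcoord a => aD.
exists [ffun j : 'I_D => nth ord0 s j] => x.
rewrite hs /feature; under [RHS]eq_bigr do rewrite ffunE.
rewrite (big_nth ord0) sz big_mkord.
rewrite (big_ord_widen _ (fun i => hcoord x (nth ord0 s i)) aD) big_mkcond /=.
apply: eq_bigr => i _; case: ltnP => // h.
by rewrite nth_default ?sz // /hcoord unlift_none.
Qed.

End Features.

(** * A reflection-invariant discrete measure by energy minimisation *)

Section Design.
Context {R : realType} {d : nat}.
Local Notation X := 'rV[R]_(d.+1).

Definition mass (P : nat) (w : 'I_P -> R) (y : 'I_P -> X) : Prop :=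
  [/\ forall i, 0 <= w i, \sum_i w i = 1 & forall i, sphere d (y i)].

Definition moment D (P : nat) (w : 'I_P -> R) (y : 'I_P -> X)
    (t : {ffun 'I_D -> 'I_d.+2}) : R := \sum_i w i * feature t (y i).

Definition energy D (P : nat) (w : 'I_P -> R) (y : 'I_P -> X) : R :=
  \sum_(t : {ffun 'I_D -> 'I_d.+2}) moment w y t ^+ 2.

(** In this form the energy depends on the nodes only through their inner products, which
    reflections preserve. *)
Lemma energyE D P w y :
  energy D w y = \sum_(i < P) \sum_(j < P) w i * w j * (1 + dot (y i) (y j)) ^+ D.
Proof.
rewrite /energy /moment; under eq_bigr do rewrite expr2 big_distrlr /=.
rewrite exchange_big; apply: eq_bigr => i _ /=.
rewrite exchange_big; apply: eq_bigr => j _ /=.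
rewrite -sum_feature mulr_sumr; apply: eq_bigr => t _; ring.
Qed.

Lemma moment_const D P w y (t : {ffun 'I_D -> 'I_d.+2}) :
  (forall j, t j = ord0) -> moment w y t = \sum_(i < P) w i.
Proof.
move=> t0; apply: eq_bigr => i _; rewrite /feature big1 ?mulr1 // => j _.
by rewrite t0 /hcoord unlift_none.
Qed.

Lemma sphere_nonempty : exists x : X, sphere d x.
Proof.
exists (delta_mx ord0 ord0); apply/sphereP; rewrite /dot (bigD1 ord0) //=.
rewrite !mxE !eqxx mulr1 big1 ?addr0 // => i /negbTE i0.
by rewrite !mxE eqxx i0 mulr0.
Qed.

Lemma continuous_sum (T : topologicalType) (I : Type) (r : seq I) (F : I -> T -> R) :
  (forall i, continuous (F i)) -> continuous (fun x => \sum_(i <- r) F i x).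
Proof. by move=> h; apply: continuous_big => //; exact: add_continuous. Qed.

Lemma continuous_prod (T : topologicalType) (I : Type) (r : seq I) (F : I -> T -> R) :
  (forall i, continuous (F i)) -> continuous (fun x => \prod_(i <- r) F i x).
Proof. by move=> h; apply: continuous_big => //; exact: mul_continuous. Qed.

Lemma continuous_mul (T : topologicalType) (f g : T -> R) :
  continuous f -> continuous g -> continuous (fun x => f x * g x).
Proof. by move=> hf hg x; apply: cvgM; [exact: hf|exact: hg]. Qed.

Lemma exists_energy_min D P : (0 < P)%N ->
  exists (w : 'I_P -> R) (y : 'I_P -> X), mass w y /\
    forall w' y', mass w' y' -> energy D w y <= @energy D P w' y'.
Proof.
move=> P0.
(* Weights and nodes are packed into one row vector, column 0 of each block holding the weight, so
   that the extreme value theorem applies. *)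
pose V := 'rV[R]_(P * d.+2).
pose w (v : V) i := v ord0 (mxvec_index i ord0).
pose y (v : V) (i : 'I_P) : X := \row_j v ord0 (mxvec_index i (lift ord0 j)).
have cw i : continuous (w ^~ i) by exact: coord_continuous.
have cy i j : continuous (fun v => y v i ord0 j).
  have -> : (fun v => y v i ord0 j) = (fun v : V => v ord0 (mxvec_index i (lift ord0 j))).
    by apply/funext => v; rewrite mxE.
  exact: coord_continuous.
have cl (f : V -> R) (D' : set R) : continuous f -> closed D' -> closed (f @^-1` D').
  by move=> cf; apply: preimage_closed => v _; exact: cf.
(* Nonnegative weights summing to 1 and coordinates of unit vectors all lie in [[-1, 1]]. *)
pose box : set V := [set v | forall k, `[(-1)%R, 1%R]%classic (v ord0 k)].
have cbox : compact box.
  apply: (@rV_compact R _ (fun=> `[(-1)%R, 1%R]%classic)) => i; exact: segment_compact.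
pose B : set V := (\bigcap_(i in [set: 'I_P]) ((w ^~ i) @^-1` [set a | 0 <= a])) `&`
  ((fun v => \sum_i w v i) @^-1` [set a | a = 1]) `&`
  (\bigcap_(i in [set: 'I_P]) ((fun v => dot (y v i) (y v i)) @^-1` [set a | a = 1])).
have cB : closed B.
  apply: closedI; first apply: closedI.
  - by apply: closed_bigI => i _; apply: cl => //; exact: closed_ge.
  - by apply: cl; [exact: continuous_sum|exact: closed_eq].
  - apply: closed_bigI => i _; apply: cl; last exact: closed_eq.
    by apply: continuous_sum => j; exact: continuous_mul.
have BP v : B v <-> mass (w v) (y v).
  split=> [[[h1 h2] h3]|[h1 h2 h3]].
    by split=> // i; [exact: h1|apply/sphereP; exact: h3].
  by split; [split => // i _; exact: h1|move=> i _; apply/sphereP].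
have cA : compact (box `&` B) by exact: compact_closedI.
pose code (w' : 'I_P -> R) (y' : 'I_P -> X) : V :=
  mxvec (\matrix_(i < P, k < d.+2) oapp (y' i ord0) (w' i) (unlift ord0 k)).
have wcode w' y' i : w (code w' y') i = w' i.
  by rewrite /w mxvecE mxE unlift_none.
have ycode w' y' i : y (code w' y') i = y' i.
  by apply/rowP => j; rewrite mxE mxvecE mxE liftK.
have codeA w' y' : mass w' y' -> (box `&` B) (code w' y').
  move=> h; split; last first.
    apply/BP; case: h => h1 h2 h3.
    split=> [i||i]; rewrite ?wcode ?ycode //.
    by under eq_bigr do rewrite wcode.
  move=> k; case/mxvec_indexP: k => i j; rewrite mxvecE mxE /= in_itv /=.
  case: h => h1 h2 h3; case: unliftP => [j' _|_] /=.
    by rewrite -ler_norml coord_sphere_le1.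
  rewrite (le_trans _ (h1 i)) ?lerN10 //= -h2 (bigD1 i) //= lerDl.
  exact: sumr_ge0.
have [v vA vmin] : exists2 v, v \in box `&` B &
    forall u, u \in box `&` B -> energy D (w v) (y v) <= energy D (w u) (y u).
  apply: compact_EVT_min => //.
    have [x0 hx0] := sphere_nonempty.
    exists (code (fun i => (i == Ordinal P0)%:R) (fun=> x0)); apply: codeA.
    split => //; rewrite (bigD1 (Ordinal P0)) //= big1 ?addr0 //.
    by move=> i /negbTE ->.
  apply: continuous_subspaceT; rewrite /energy /moment.
  have cm t : continuous (fun v => \sum_i w v i * feature t (y v i)).
    apply: continuous_sum => i; apply: continuous_mul; first exact: cw.
    apply: continuous_prod => j; rewrite /hcoord; case: unlift => [k|] /=.
      exact: cy.
    exact: cst_continuous.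
  apply: continuous_sum => t.
  exact: (continuous_mul (cm _ t) (cm _ t)).
exists (w v), (y v); split; first by apply/BP; case/set_mem: vA.
move=> w' y' h; apply: le_trans (vmin (code w' y') _) _.
  by apply/mem_set; exact: codeA.
rewrite le_eqVlt; apply/orP; left; apply/eqP; congr energy.
  by apply/funext => i; exact: wcode.
by apply/funext => i; exact: ycode.
Qed.

(** Every polynomial of degree at most [D] is a combination of features, so it suffices that the
    minimiser and its reflection have the same moments. *)
Lemma exists_invariant_design D :
  exists (P : nat) (w : 'I_P -> R) (y : 'I_P -> X), mass w y /\
  forall v p, poly_le D p ->
    \sum_i w i * p (refl v (y i)) = \sum_i w i * p (y i).
Proof.
pose J : finType := {ffun 'I_D -> 'I_d.+2}.
pose o : J := [ffun=> ord0].
have J0 : (0 < #|J|)%N by apply/card_gt0P; exists o.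
have [w [y [[w0 w1 yS] hmin]]] := exists_energy_min D J0.
exists #|J|, w, y; split => // v.
pose yv i := refl v (y i).
suff mom (t : J) : moment w yv t = moment w y t.
  move=> p [s [/allP sD ps]].
  under eq_bigr do rewrite ps mulr_sumr; under [RHS]eq_bigr do rewrite ps mulr_sumr.
  rewrite exchange_big [RHS]exchange_big /=; apply: eq_big_seq => u /sD uD.
  have [t ht] := @monomial_feature R d D u.2 uD.
  under eq_bigr do rewrite mulrCA; under [RHS]eq_bigr do rewrite mulrCA.
  rewrite -!mulr_sumr; congr (_ * _).
  under eq_bigr do rewrite ht; under [RHS]eq_bigr do rewrite ht.
  exact: mom.
have eyv : energy D w yv = energy D w y.
  rewrite !energyE; apply: eq_bigr => i _; apply: eq_bigr => j _.
  by rewrite dot_refl.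
(* The half-half mixture of the minimiser and its reflection has, by the
   parallelogram law, strictly smaller energy unless their moments agree. *)
pose wm (i : 'I_(#|J| + #|J|)) := match fintype.split i with inl i => w i / 2 | inr i => w i / 2 end.
pose ym (i : 'I_(#|J| + #|J|)) := match fintype.split i with inl i => y i | inr i => yv i end.
have wm0 i : 0 <= wm i by rewrite /wm; case: fintype.split => j; rewrite divr_ge0.
have ymS i : sphere d (ym i).
  by rewrite /ym; case: fintype.split => j //; exact: refl_sphere.
have JJ0 : (0 < #|J| + #|J|)%N by rewrite addn_gt0 J0.
(* The mixture lives on twice as many nodes; Caratheodory returns it to [#|J|] nodes with the same
   moments, where minimality applies. *)
have [w' [y' [w'0 y'S hw']]] :=
  conic_caratheodory (fun (t : J) x => feature t x) JJ0 J0 wm0 ymS.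
have momm (u : J) : moment w' y' u = (moment w y u + moment w yv u) / 2.
  rewrite [LHS]hw' big_split_ord /= mulrDl !mulr_suml; congr (_ + _);
  apply: eq_bigr => i _; rewrite /wm /ym.
    by rewrite (unsplitK (inl i)) mulrAC.
  by rewrite (unsplitK (inr i)) mulrAC.
have t00 j : o j = ord0 by rewrite ffunE.
(* The total mass is the moment of the constant feature [o], so it is 1 again. *)
have /hmin : mass w' y'.
  split => //; rewrite -(moment_const w' y' t00) momm !moment_const // w1.
  by rewrite -[1 + 1]/(2%:R) divff.
have -> : energy D w' y' = energy D w y
    - \sum_(t : J) ((moment w yv t - moment w y t) / 2) ^+ 2.
  transitivity ((energy D w y + energy D w yv) / 2
    - \sum_(t : J) ((moment w yv t - moment w y t) / 2) ^+ 2); last first.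
    by rewrite eyv; congr (_ - _); field.
  rewrite /energy -big_split /= mulr_suml -sumrB; apply: eq_bigr => u _.
  by rewrite momm; field.
rewrite lerBrDl gerDr => h.
have /psumr_eq0P z : \sum_(t : J) ((moment w yv t - moment w y t) / 2) ^+ 2 = 0.
  by apply/eqP; rewrite eq_le h sumr_ge0 // => u _; exact: sqr_ge0.
have /(_ (fun u _ => sqr_ge0 _) t isT)/eqP := z.
rewrite sqrf_eq0 mulf_eq0 invr_eq0 pnatr_eq0 orbF subr_eq0 => /eqP; exact.
Qed.

End Design.

(** * Orthonormal bases and reproducing kernel of the discrete inner product *)

Section ReproducingKernel.
Context {R : realType} {d : nat}.
Local Notation X := 'rV[R]_(d.+1).
Context {P D : nat} (w : 'I_P -> R) (y : 'I_P -> X).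
Hypothesis wy : mass w y.
Hypothesis invar : forall v p, poly_le D p ->
  \sum_i w i * p (refl v (y i)) = \sum_i w i * p (y i).

Definition ip (p q : X -> R) : R := \sum_i w i * (p (y i) * q (y i)).

Lemma ipC p q : ip p q = ip q p.
Proof. by apply: eq_bigr => i _; rewrite (mulrC (p _)). Qed.

Lemma ipDl p q s : ip (fun x => p x + q x) s = ip p s + ip q s.
Proof. by rewrite -big_split; apply: eq_bigr => i _ /=; ring. Qed.

Lemma ipZl c p s : ip (fun x => c * p x) s = c * ip p s.
Proof. by rewrite mulr_sumr; apply: eq_bigr => i _ /=; ring. Qed.

Lemma ip_suml k (c : 'I_k -> R) (b : 'I_k -> X -> R) s :
  ip (fun x => \sum_i c i * b i x) s = \sum_i c i * ip (b i) s.
Proof.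
under [RHS]eq_bigr do rewrite mulr_sumr.
rewrite exchange_big; apply: eq_bigr => i _ /=.
rewrite mulr_suml mulr_sumr; apply: eq_bigr => j _ /=; ring.
Qed.

Lemma ip_sphere p p' q q' : (forall x, sphere d x -> p x = p' x) ->
  (forall x, sphere d x -> q x = q' x) -> ip p q = ip p' q'.
Proof.
by case: wy => _ _ yS h h'; apply: eq_bigr => i _; rewrite h ?h'.
Qed.

Lemma ip_refl N v p q : (N + N <= D)%N -> poly_le N p -> poly_le N q ->
  ip (fun x => p (refl v x)) (fun x => q (refl v x)) = ip p q.
Proof.
by move=> ND hp hq; exact: (invar v (poly_leW ND (poly_leM hp hq))).
Qed.

Lemma ip_ge0 p : 0 <= ip p p.
Proof.
by case: wy => w0 _ _; apply: sumr_ge0 => i _; rewrite mulr_ge0 // -expr2 sqr_ge0.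
Qed.

(** By invariance the reflected [p] has zero norm too, so it vanishes at a node of nonzero weight;
    the reflection is chosen to carry that node to [x]. *)
Lemma ip_eq0 N p : (N + N <= D)%N -> poly_le N p -> ip p p = 0 ->
  forall x, sphere d x -> p x = 0.
Proof.
case: wy => w0 w1 yS ND hp p0 x xS.
have [i wi] : exists i, w i != 0.
  apply/existsP; apply: contraT; rewrite negb_exists => /forallP h.
  have := oner_neq0 R; rewrite -w1 big1 ?eqxx // => i _.
  by have := h i; rewrite negbK => /eqP.
have := ip_refl (y i - x) ND hp hp; rewrite p0 => /psumr_eq0P => /(_ _ i isT) /=.
rewrite refl_swap // => h.
have /eqP := h (fun j _ => mulr_ge0 (w0 j) (sqr_ge0 _)).
by rewrite mulf_eq0 (negbTE wi) /= -expr2 sqrf_eq0 => /eqP.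
Qed.

Definition orthonormal N k (b : 'I_k -> X -> R) : Prop :=
  (forall i, poly_le N (b i)) /\ forall i j, ip (b i) (b j) = (i == j)%:R.

Lemma ip_orthonormal N k (b : 'I_k -> X -> R) (c : 'I_k -> R) j : orthonormal N b ->
  ip (fun x => \sum_i c i * b i x) (b j) = c j.
Proof.
move=> [_ h]; rewrite ip_suml (bigD1 j) //= h eqxx mulr1 big1 ?addr0 // => i ij.
by rewrite h (negbTE ij) mulr0.
Qed.

Lemma orthonormal_indep N k (b : 'I_k -> X -> R) : orthonormal N b -> indep_on_sphere b.
Proof.
move=> h c hc j; rewrite -(ip_orthonormal c j h).
rewrite (@ip_sphere _ (fun=> 0) _ (b j)) //.
by rewrite /ip big1 // => i _; rewrite mul0r mulr0.
Qed.

(** The inner product sees only the values at the [P] nodes, where a longer family would be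
    dependent. This bound makes an orthonormal family of maximal size exist. *)
Lemma orthonormal_size N k (b : 'I_k -> X -> R) : orthonormal N b -> (k <= P)%N.
Proof.
move=> h; rewrite leqNgt; apply/negP => Pk.
have [|v [j vj] hv] := @linear_dependence R 'I_P k (fun i l => b i (y l)).
  by rewrite card_ord.
case/eqP: vj; rewrite -(ip_orthonormal v j h) /ip big1 // => i _.
by rewrite hv mul0r mulr0.
Qed.

(** A Gram-Schmidt step: the residual [q] of [p] is orthogonal to a family of maximal size, so if
    its norm were nonzero the normalised [q] would extend the family. *)
Lemma exists_orthonormal_basis N : (N + N <= D)%N ->
  exists k (b : 'I_k -> X -> R), orthonormal N b /\
    forall p, poly_le N p -> forall x, sphere d x -> p x = \sum_i ip p (b i) * b i x.
Proof.
move=> ND; pose Q k := `[< exists b : 'I_k -> X -> R, orthonormal N b >].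
have Q0 : exists k, Q k.
  by exists 0%N; apply/asboolP; exists (fun _ _ => 0); split => [[]|[]].
have Qb k : Q k -> (k <= P)%N by move/asboolP => [b]; exact: orthonormal_size.
case: (ex_maxnP Q0 Qb) => k /asboolP[b hb] kmax; exists k, b; split => // p hp.
pose q x := p x + \sum_i (- ip p (b i)) * b i x.
have hq : poly_le N q.
  apply: poly_leD => //; apply: poly_le_sum => i; apply: poly_leZ.
  by case: hb.
have qb j : ip q (b j) = 0 by rewrite ipDl (ip_orthonormal _ _ hb) subrr.
suff q0 : ip q q = 0.
  move=> x xS; have := ip_eq0 ND hq q0 xS; rewrite /q.
  under eq_bigr do rewrite mulNr.
  by rewrite sumrN => /eqP; rewrite subr_eq0 => /eqP.
apply/eqP; apply: contraT => q0.
have qp : 0 < ip q q by rewrite lt_neqAle eq_sym q0 ip_ge0.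
pose a := (Num.sqrt (ip q q))^-1.
suff /kmax : Q k.+1 by rewrite ltnn.
apply/asboolP.
exists (fun i => oapp b (fun x => a * q x) (unlift ord0 i)); split=> [i|i j].
  by case: unliftP => [j _|_] /=; [case: hb|exact: poly_leZ].
case: unliftP => [i' ->|->]; case: unliftP => [j' ->|->] /=.
- by case: hb => _ ->; rewrite (inj_eq lift_inj).
- by rewrite ipC ipZl ipC ipC qb mulr0.
- by rewrite ipZl qb mulr0.
- rewrite ipZl ipC ipZl mulrA -expr2 /a exprVn sqr_sqrtr ?ltW // mulVf //.
Qed.

Section Kernel.
Context {N k : nat} (b : 'I_k -> X -> R).
Hypothesis ND : (N + N <= D)%N.
Hypothesis hb : orthonormal N b.
Hypothesis basis : forall p, poly_le N p ->
  forall x, sphere d x -> p x = \sum_i ip p (b i) * b i x.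

Definition kernel x z : R := \sum_i b i x * b i z.

Lemma kernelC x z : kernel x z = kernel z x.
Proof. by apply: eq_bigr => i _; rewrite mulrC. Qed.

Lemma poly_le_kernel x : poly_le N (kernel x).
Proof. by apply: poly_le_sum => i; apply: poly_leZ; case: hb. Qed.

Lemma kernel_reproducing p x : poly_le N p -> sphere d x -> ip (kernel x) p = p x.
Proof.
move=> hp xS; rewrite ip_suml (basis hp xS); apply: eq_bigr => i _.
by rewrite mulrC ipC.
Qed.

(* The product of [kernel x] and [kernel (refl v x) \o refl v] integrates to
   either diagonal value, depending on which factor is used to reproduce. *)
Lemma kernel_diag_refl v x : sphere d x ->
  kernel (refl v x) (refl v x) = kernel x x.
Proof.
move=> xS; have vxS : sphere d (refl v x) by exact: refl_sphere.
rewrite -(kernel_reproducing (poly_le_refl v (poly_le_kernel (refl v x))) xS).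
rewrite -(ip_refl v ND (poly_le_kernel x)) ?poly_le_refl //; last first.
  by apply: poly_le_refl; exact: poly_le_kernel.
under [X in ip _ X]eq_fun do rewrite reflK.
rewrite ipC kernel_reproducing ?reflK //.
by apply: poly_le_refl; exact: poly_le_kernel.
Qed.

(** Transitivity of reflections makes the diagonal constant, and its mean over the nodes is the sum
    of the [k] squared norms [ip (b j) (b j) = 1]. *)
Lemma kernel_diag x : sphere d x -> kernel x x = k%:R.
Proof.
move=> xS; case: wy => _ w1 yS.
have -> : k%:R = \sum_i w i * kernel (y i) (y i).
  transitivity (\sum_(j < k) ip (b j) (b j)).
    case: hb => _ h; under eq_bigr do rewrite h eqxx.
    by rewrite sumr_const card_ord.
  rewrite exchange_big; apply: eq_bigr => i _; by rewrite mulr_sumr.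
rewrite -[LHS]mul1r -w1 mulr_suml; apply: eq_bigr => i _; congr (_ * _).
by rewrite -(refl_swap xS (yS i)) kernel_diag_refl.
Qed.

End Kernel.
End ReproducingKernel.

(** * Upper and lower bounds for the dimension of the polynomial spaces *)

Lemma digits_inj B n (a b : 'I_n -> nat) :
  (forall i, a i < B)%N -> (forall i, b i < B)%N ->
  (\sum_(i < n) a i * B ^ i = \sum_(i < n) b i * B ^ i)%N -> a =1 b.
Proof.
elim: n a b => [|n IH] a b ha hb; first by move=> _ [].
have hd (c : 'I_n.+1 -> nat) : (\sum_(i < n.+1) c i * B ^ i =
    (\sum_(i < n) c (lift ord0 i) * B ^ i) * B + c ord0)%N.
  rewrite big_ord_recl expn0 muln1 addnC big_distrl; congr (_ + _)%N.
  by apply: eq_bigr => i _; rewrite lift0 expnS mulnCA mulnC.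
rewrite !hd => e.
have B0 : (0 < B)%N by exact: leq_ltn_trans (ha ord0).
have e0 : a ord0 = b ord0.
  have := congr1 (modn^~ B) e.
  by rewrite !modnMDl !modn_small.
have et : (\sum_(i < n) a (lift ord0 i) * B ^ i = \sum_(i < n) b (lift ord0 i) * B ^ i)%N.
  by move: e; rewrite e0 => /addIn/eqP; rewrite eqn_pmul2r // => /eqP.
move=> i; case: (unliftP ord0 i) => [j ->|-> //].
by apply: (IH (fun i => a (lift ord0 i)) (fun i => b (lift ord0 i))).
Qed.

Section Dimension.
Context {R : realType} {d : nat}.
Local Notation X := 'rV[R]_(d.+2).
Local Notation Z := 'rV[R]_(d.+1).

Definition tail (x : X) : Z := \row_j x ord0 (lift ord0 j).

Definition exponents N : finType :=
  {t : d.+1.-tuple 'I_N.+1 | (\sum_(i <- t) i <= N)%N}.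

Lemma card_exponents N : #|exponents N| = 'C(d.+1 + N, d.+1).
Proof. by rewrite card_sig -card_partial_ord_partitions cardsE. Qed.

Definition exponent N (t : exponents N) (i : 'I_d.+1) : nat := tnth (val t) i.

Lemma mdeg_exponent N (t : exponents N) : (mdeg (exponent t) <= N)%N.
Proof. by rewrite (leq_trans _ (valP t)) // [X in (_ <= X)%N]big_tuple. Qed.

Lemma exponent_surj N (a : 'I_d.+1 -> nat) : (mdeg a <= N)%N ->
  exists t : exponents N, exponent t =1 a.
Proof.
move=> aN; pose t : d.+1.-tuple 'I_N.+1 := [tuple inord (a i) | i < d.+1].
have ta i : tnth t i = a i :> nat.
  rewrite tnth_mktuple inordK // ltnS (leq_trans _ aN) //.
  by rewrite /mdeg (bigD1 i) //= leq_addr.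
have tN : (\sum_(i <- t) i <= N)%N.
  by rewrite big_tuple; under eq_bigr do rewrite ta.
by exists (Sub t tN).
Qed.

Lemma dot_tail (x : X) : dot x x = x ord0 ord0 ^+ 2 + dot (tail x) (tail x).
Proof.
rewrite /dot big_ord_recl expr2; congr (_ + _); apply: eq_bigr => i _.
by rewrite !mxE.
Qed.

Definition low_monomial N (u : exponents N * bool) (x : X) : R :=
  x ord0 ord0 ^+ u.2 * monomial (exponent u.1) (tail x).

Lemma in_span_low N (Q : Z -> R) (e : bool) : poly_le N Q ->
  in_span (@low_monomial N) (fun x => x ord0 ord0 ^+ e * Q (tail x)).
Proof.
move=> [s [hs hQ]].
apply: (@in_span_ext _ _ _ _ (fun x => x ord0 ord0 ^+ e *
    \sum_(t <- s) t.1 * monomial t.2 (tail x))).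
  by move=> x _; rewrite hQ.
elim: s hs {hQ} => [_|[c a] s IH /= /andP[aN hs]].
  exists (fun=> 0) => x _; rewrite big_nil mulr0 big1 // => u _; exact: mul0r.
have [t ta] := exponent_surj aN.
apply: in_span_ext (in_spanD (in_spanZ c (in_span_gen (@low_monomial N) (t, e))) (IH hs)).
move=> x _; rewrite big_cons mulrDr /low_monomial /=; congr (_ + _).
have -> : monomial (exponent t) (tail x) = monomial a (tail x).
  by apply: eq_bigr => i _; rewrite ta.
ring.
Qed.

(* On the sphere, x_0^2 = 1 - |x'|^2 reduces the exponent of x_0 to its parity. *)
Lemma in_span_poly_le N (p : X -> R) : poly_le N p -> in_span (@low_monomial N) p.
Proof.
move=> [s [hs hp]].
apply: (@in_span_ext _ _ _ _ (fun x => \sum_(t <- s) t.1 * monomial t.2 x)) => //.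
elim: s hs {hp} => [_|[c a] s IH /= /andP[aN hs]].
  exists (fun=> 0) => x _; rewrite big_nil big1 // => u _; exact: mul0r.
pose Q (z : Z) := (1 - dot z z) ^+ (a ord0)./2 * monomial (fun i => a (lift ord0 i)) z.
have hQ : poly_le N Q.
  have h2 : poly_le 2 (fun z : Z => 1 - dot z z).
    apply: poly_leD; first exact: poly_le_cst.
    apply: poly_leN; apply: poly_le_sum => i.
    exact: poly_leM (poly_le_coord i) (poly_le_coord i).
  have h := poly_leM (poly_leX (a ord0)./2 h2)
              (poly_le_monomial (leqnn (mdeg (fun i : 'I_d.+1 => a (lift ord0 i))))).
  apply: poly_leW h; rewrite (leq_trans _ aN) // /mdeg [X in (_ <= X)%N]big_ord_recl leq_add2r.
  by rewrite -{2}(odd_double_half (a ord0)) muln2 leq_addl.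
apply: in_span_ext (in_spanD (in_spanZ c (in_span_low (odd (a ord0)) hQ)) (IH hs)).
move=> x /sphereP; rewrite dot_tail => xS; rewrite big_cons; congr (_ * _ + _).
rewrite /Q mulrA /monomial [RHS]big_ord_recl; congr (_ * _); last first.
  by apply: eq_bigr => i _; rewrite mxE.
have -> : 1 - dot (tail x) (tail x) = x ord0 ord0 ^+ 2 by rewrite -xS addrK.
by rewrite -exprM mul2n -exprD odd_double_half.
Qed.

Lemma indep_size_le N k (ps : 'I_k -> X -> R) :
  indep_on_sphere ps -> (forall i, poly_le N (ps i)) ->
  (k <= 2 * 'C(d.+1 + N, d.+1))%N.
Proof.
move=> hi hp; have := indep_le_span hi (fun i => in_span_poly_le (hp i)).
by rewrite card_prod card_exponents card_bool mulnC.
Qed.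

(* Kronecker substitution: along the curve x'_i = s^(B^i) / (d+1) with B = N+1
   distinct monomials become distinct powers of s. *)
Lemma tail_monomials_indep N (c : exponents N -> R) :
  (forall x, sphere d.+1 x -> \sum_t c t * monomial (exponent t) (tail x) = 0) ->
  forall t, c t = 0.
Proof.
(* The scale [1/(d+1)] keeps the curve inside the unit ball, so that coordinate 0 can be chosen to
   reach the sphere. *)
move=> h; pose eta : R := d.+1%:R^-1.
have eta0 : 0 < eta by rewrite invr_gt0 ltr0n.
pose code (t : exponents N) := (\sum_(i < d.+1) exponent t i * N.+1 ^ i)%N.
have code_inj : injective code.
  move=> s t /digits_inj e; apply/val_inj/eq_from_tnth => i; apply: val_inj.
  by apply: e => j; exact: ltn_ord.
pose q : {poly R} := \sum_t (c t * eta ^+ mdeg (exponent t)) *: 'X^(code t).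
have qs s : 0 < s -> s <= 1 -> q.[s] = 0.
  move=> s0 s1; pose z : Z := \row_i (eta * s ^+ (N.+1 ^ i)).
  have z1 : dot z z <= 1.
    apply: (@le_trans _ _ (\sum_(i < d.+1) eta)).
      apply: ler_sum => i _; rewrite mxE -expr2.
      have zi : eta * s ^+ (N.+1 ^ i) <= eta by rewrite ler_piMr ?exprn_ile1 // ltW.
      have e1 : eta <= 1 by rewrite invf_le1 ?ler1n ?ltr0n.
      have u0 : 0 <= eta * s ^+ (N.+1 ^ i) by rewrite mulr_ge0 ?exprn_ge0 // ltW.
      by move: (eta * _) u0 zi => u u0 ue; rewrite expr2; nra.
    by rewrite sumr_const card_ord -[_ *+ _]mulr_natl divff ?pnatr_eq0.
  pose x : X := \row_i oapp (z ord0) (Num.sqrt (1 - dot z z)) (unlift ord0 i).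
  have tx : tail x = z by apply/rowP => i; rewrite mxE mxE liftK.
  have xS : sphere d.+1 x.
    by apply/sphereP; rewrite dot_tail tx mxE unlift_none /= sqr_sqrtr ?subrK ?subr_ge0.
  rewrite -(h x xS) tx /q horner_sum; apply: eq_bigr => t _.
  rewrite hornerZ hornerXn -mulrA; congr (_ * _).
  rewrite /monomial /mdeg /code -prodrXr -[in s ^+ _]prodrXr -big_split /=.
  by apply: eq_bigr => i _; rewrite mxE exprMn -exprM mulnC.
have q0 : q = 0.
  apply/eqP; apply: contraT => qn0.
  (* The numbers [1/(m+1)] give [size q] distinct roots in [(0, 1]], one more than a nonzero [q]
     allows. *)
  pose rs : seq R := [seq m.+1%:R^-1 | m <- iota 0 (size q)].
  have /(max_poly_roots qn0) : all (root q) rs.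
    apply/allP => _ /mapP[m _ ->]; rewrite rootE qs ?invr_gt0 ?ltr0n //.
    by rewrite invf_le1 ?ler1n ?ltr0n.
  rewrite size_map size_iota ltnn => -> //.
  rewrite map_inj_uniq ?iota_uniq // => m m' /invr_inj/eqP.
  by rewrite eqr_nat => /eqP [].
move=> t; have : q`_(code t) = 0 by rewrite q0 coef0.
rewrite coef_sum (bigD1 t) //= coefZ coefXn eqxx mulr1 big1 ?addr0.
  by move/eqP; rewrite mulf_eq0 expf_eq0 (gt_eqF eta0) andbF orbF => /eqP.
by move=> s st; rewrite coefZ coefXn (inj_eq code_inj) eq_sym (negbTE st) mulr0.
Qed.

(** Monomials free of coordinate 0 are independent on the sphere. The upper bound [indep_size_le] is
    twice this one, which costs a factor 2 in the ratio of dimensions. *)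
Lemma basis_size_ge N k (b : 'I_k -> X -> R) :
  (forall p, poly_le N p -> in_span b p) -> ('C(d.+1 + N, d.+1) <= k)%N.
Proof.
move=> hb; rewrite -card_exponents -[k in (_ <= k)%N]card_ord.
pose ps (i : 'I_#|exponents N|) (x : X) := monomial (exponent (enum_val i)) (tail x).
apply: (@indep_le_span R _ _ b _ ps) => [c hc i|i].
  rewrite -[i]enum_valK.
  apply: (@tail_monomials_indep N (fun t => c (enum_rank t))) => x xS.
  rewrite -[RHS](hc x xS) (reindex_onto enum_rank enum_val) => [|j _]; last exact: enum_valK.
  by apply: eq_big => [t|t _]; rewrite /ps enum_rankK ?eqxx.
pose a (j : 'I_d.+2) := oapp (exponent (enum_val i)) 0%N (unlift ord0 j).
have aN : (mdeg a <= N)%N.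
  rewrite /mdeg big_ord_recl {1}/a unlift_none add0n.
  by under eq_bigr do rewrite /a liftK /=; exact: mdeg_exponent.
apply: hb; apply: poly_le_ext (poly_le_monomial aN) => x.
rewrite /ps /monomial big_ord_recl {1}/a unlift_none expr0 mul1r.
by apply: eq_bigr => j _; rewrite /a liftK mxE.
Qed.

End Dimension.

(** * Chebyshev polynomials and a localised power of the Dirichlet kernel *)

Section DirichletKernel.
Context {R : realType}.
Implicit Types t : R.

Fixpoint cheb n t : R :=
  match n with
  | 0 => 1
  | n'.+1 => match n' with 0 => t | m.+1 => 2 * t * cheb n' t - cheb m t end
  end.

Lemma chebSS n t : cheb n.+2 t = 2 * t * cheb n.+1 t - cheb n t.
Proof. by []. Qed.

(** The three-term recurrence conserves this quadratic form, whose value at [t = cos a] is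
    [sin(a)^2]. *)
Lemma cheb_invariant n t :
  cheb n.+1 t ^+ 2 + cheb n t ^+ 2 - 2 * t * cheb n t * cheb n.+1 t = 1 - t ^+ 2.
Proof.
elim: n => [|n IH]; first by rewrite /=; ring.
by rewrite -IH chebSS; ring.
Qed.

(** Completing the square in the invariant gives [(T_(n+1) - t T_n)^2 = (1 - t^2)(1 - T_n^2)]. When
    [t^2 = 1] this forces [T_(n+1) = t T_n], and induction concludes. *)
Lemma cheb_sqr_le1 n t : t ^+ 2 <= 1 -> cheb n t ^+ 2 <= 1.
Proof.
move=> t1; have e m : (cheb m.+1 t - t * cheb m t) ^+ 2 = (1 - t ^+ 2) * (1 - cheb m t ^+ 2).
  by rewrite mulrBr mulr1 -{1}(cheb_invariant m t); ring.
have [tt|tn] := eqVneq (t ^+ 2) 1; last first.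
  have t0 : 0 < 1 - t ^+ 2 by rewrite subr_gt0 lt_neqAle tn.
  by rewrite -subr_ge0 -(pmulr_rge0 _ t0) -e sqr_ge0.
suff -> : cheb n t ^+ 2 = 1 by [].
elim: n => [|n IH]; first by rewrite expr1n.
have := e n; rewrite tt subrr mul0r => /eqP; rewrite sqrf_eq0 subr_eq0 => /eqP ->.
by rewrite exprMn tt IH mulr1.
Qed.

Lemma cheb1 n : cheb n 1 = 1.
Proof.
suff : cheb n 1 = 1 /\ cheb n.+1 1 = 1 by case.
elim: n => [|n [h1 h2]]; first by [].
by split => //; rewrite chebSS h1 h2; ring.
Qed.

(** At [t = cos a] this is [sin((L + 1/2) a) / sin(a / 2)]. *)
Definition dirichlet L t : R := 1 + 2 * \sum_(l < L) cheb l.+1 t.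

Lemma dirichletS L t : dirichlet L.+1 t = dirichlet L t + 2 * cheb L.+1 t.
Proof. by rewrite /dirichlet big_ord_recr /= mulrDr addrA. Qed.

Lemma dirichletSS L t :
  dirichlet L.+2 t = 2 * t * dirichlet L.+1 t - dirichlet L t.
Proof.
elim: L => [|L IH].
  by rewrite !dirichletS /dirichlet big_ord0 /=; ring.
rewrite (dirichletS L.+2) {1}IH chebSS (dirichletS L.+1) (dirichletS L).
ring.
Qed.

Lemma dirichlet_invariant L t : dirichlet L.+1 t ^+ 2 + dirichlet L t ^+ 2
  - 2 * t * dirichlet L t * dirichlet L.+1 t = 2 * (1 + t).
Proof.
elim: L => [|L IH]; first by rewrite dirichletS /dirichlet big_ord0 /=; ring.
by rewrite -IH dirichletSS; ring.
Qed.

(** At [t = cos a] this reads [|D_L| |sin(a / 2)| <= 1]. After multiplication by [1 + t], the two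
    sides differ by a square. *)
Lemma dirichlet_sqr_le L t : -1 < t -> dirichlet L t ^+ 2 * (1 - t) <= 2.
Proof.
move=> t1; have t0 : 0 < 1 + t by lra.
rewrite -(ler_pM2r t0) -(dirichlet_invariant L).
rewrite -subr_ge0 (_ : _ - _ = (dirichlet L.+1 t - t * dirichlet L t) ^+ 2) ?sqr_ge0 //.
ring.
Qed.

Lemma dirichlet_le L t : t ^+ 2 <= 1 -> `|dirichlet L t| <= (2 * L + 1)%:R.
Proof.
move=> t1; elim: L => [|L IH].
  by rewrite /dirichlet big_ord0 mulr0 addr0 normr1.
have h : `|cheb L.+1 t| <= 1.
  by rewrite -(@ler_sqr _ `|_|) ?nnegrE // expr1n real_normK ?num_real ?cheb_sqr_le1.
rewrite dirichletS (le_trans (ler_normD _ _)) // normrM (ger0_norm (x := 2)) //.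
rewrite (_ : (2 * L.+1 + 1)%N = (2 * L + 1 + 2)%N); last lia.
by rewrite natrD lerD //; lra.
Qed.

Lemma dirichlet1 L : dirichlet L 1 = (2 * L + 1)%:R.
Proof.
rewrite /dirichlet; under eq_bigr do rewrite cheb1.
by rewrite sumr_const card_ord natrD natrM addrC.
Qed.

(* The factor (1 + t) / 2 makes the antipode x = - y harmless. *)
Definition bump s L t : R := (dirichlet L t / (2 * L + 1)%:R) ^+ s * ((1 + t) / 2).

Lemma bump1 s L : bump s L 1 = 1.
Proof.
rewrite /bump dirichlet1 divff ?pnatr_eq0 ?addn1 // expr1n mul1r.
by rewrite -[1 + 1]/(2%:R) divff.
Qed.

Context {d : nat}.
Local Notation X := 'rV[R]_(d.+1).

Lemma poly_le_cheb n (y : X) : poly_le n (fun x => cheb n (dot x y)).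
Proof.
suff : poly_le n (fun x => cheb n (dot x y)) /\
       poly_le n.+1 (fun x => cheb n.+1 (dot x y)) by case.
elim: n => [|n [h1 h2]].
  by split; [exact: poly_le_cst|exact: poly_le_dot].
split=> //; have h3 := poly_leZ 2 (poly_leM (poly_le_dot y) h2).
apply: poly_le_ext (poly_leD h3 (poly_leN (poly_leW _ h1))).
  by move=> x; rewrite chebSS; ring.
by rewrite leqW.
Qed.

Lemma poly_le_bump s L (y : X) : poly_le (s * L + 1) (fun x => bump s L (dot x y)).
Proof.
apply: poly_leM.
  apply: poly_leX; set c := _%:R.
  have h : poly_le L (fun x => c^-1 * (1 + 2 * \sum_(l < L) cheb l.+1 (dot x y))).
    apply: poly_leZ; apply: poly_leD; first exact: poly_le_cst.
    apply: poly_leZ; apply: poly_le_sum => l.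
    exact: poly_leW (poly_le_cheb l.+1 y).
  by apply: poly_le_ext h => x; rewrite mulrC.
apply: (@poly_le_ext _ _ _ (fun x => 2^-1 * (1 + dot x y))).
  by move=> x; rewrite mulrC.
apply: poly_leZ; apply: poly_leD; first exact: poly_le_cst.
exact: poly_le_dot.
Qed.

Context (x y : X).
Hypotheses (xS : sphere d x) (yS : sphere d y).

Lemma dirichlet_dot_le1 L : `|dirichlet L (dot x y) / (2 * L + 1)%:R| <= 1.
Proof.
rewrite normrM normfV normr_nat ler_pdivrMr ?ltr0n ?addn1 // mul1r -addn1.
apply: dirichlet_le; have := dot_le1 xS yS; have := dot_geN1 xS yS; nra.
Qed.

Lemma bump_factor : `|(1 + dot x y) / 2| <= 1.
Proof.
by rewrite ler_norml; have := dot_le1 xS yS; have := dot_geN1 xS yS; lra.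
Qed.

Lemma bump_le1 s L : `|bump s L (dot x y)| <= 1.
Proof.
rewrite normrM mulr_ile1 ?normr_ge0 ?bump_factor // normrX exprn_ile1 //.
exact: dirichlet_dot_le1.
Qed.

(** Since [|x - y|^2 = 2 - 2 x.y], one has [|D_L| |x - y| <= 2]; each of the [s] normalised factors
    then contributes at most [2 (2 s)]. *)
Lemma bump_decay s L (n : R) : (0 < s)%N -> 0 <= n -> n <= (2 * s%:R) * (2 * L + 1)%:R ->
  `|bump s L (dot x y)| * (n * enorm (x - y)) ^+ s <= (4 * s%:R) ^+ s.
Proof.
move=> s0 n0 nL; set D := enorm (x - y).
have D0 : 0 <= D := enorm_ge0 _.
have [t1|] := ltP (-1) (dot x y); last first.
  move=> tm; have -> : dot x y = -1.
    by apply/eqP; rewrite eq_le tm dot_geN1.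
  by rewrite /bump subrr mul0r mulr0 normr0 mul0r exprn_ge0.
rewrite normrM normrX.
apply: (@le_trans _ _ ((`|dirichlet L (dot x y) / (2 * L + 1)%:R| * (n * D)) ^+ s)).
  rewrite [leRHS]exprMn ler_wpM2r ?exprn_ge0 ?mulr_ge0 //.
  by rewrite ler_piMr ?exprn_ge0 ?bump_factor.
apply: lerXn2r; rewrite ?nnegrE ?mulr_ge0 //.
have V2 : `|dirichlet L (dot x y)| * D <= 2.
  rewrite -(@ler_sqr _ (_ * _)) ?nnegrE ?mulr_ge0 // exprMn real_normK ?num_real //.
  by rewrite enormB_sqr //; have := dirichlet_sqr_le L t1; lra.
set K := (2 * L + 1)%:R in nL *.
have K0 : 0 < K by rewrite ltr0n addn1.
have -> : `|dirichlet L (dot x y) / K| * (n * D) = (`|dirichlet L (dot x y)| * D) * (n / K).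
  by rewrite normrM normfV (gtr0_norm K0); ring.
have -> : 4 * s%:R = 2 * (2 * s%:R) :> R by ring.
by apply: ler_pM => //; rewrite ?mulr_ge0 ?invr_ge0 ?ler_pdivrMr // ltW.
Qed.

End DirichletKernel.

(** * Growth of polynomials along great circles *)

Section Growth.
Context {R : realType}.

(** After rescaling by [eta], the coefficients are recovered by inverting the Vandermonde matrix of
    the nodes [i/(K+1)] with [1 <= i <= K+1]. The node 0 is avoided because [q] is bounded only for
    [s > 0]. *)
Lemma poly_coef_bound K : exists2 C : R, 0 < C & forall (q : {poly R}) (B eta : R),
  (size q <= K.+1)%N -> 0 < eta ->
  (forall s, 0 < s -> s <= eta -> `|q.[s]| <= B) ->
  forall j, `|q`_j| * eta ^+ j <= C * B.
Proof.
pose a : 'rV[R]_K.+1 := \row_i (i.+1%:R / K.+1%:R).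
have a0 i : 0 < a ord0 i by rewrite mxE divr_gt0 ?ltr0n.
have a1 i : a ord0 i <= 1 by rewrite mxE ler_pdivrMr ?ltr0n // mul1r ler_nat.
pose V := Vandermonde K.+1 a.
have Vu : V \in unitmx.
  rewrite unitmxE det_Vandermonde unitfE; apply/prodf_neq0 => i _.
  apply/prodf_neq0 => j ij; rewrite subr_eq0 !mxE.
  rewrite (inj_eq (mulIf _)) ?invr_eq0 ?pnatr_eq0 // eqr_nat eqSS.
  by rewrite gtn_eqF.
pose C := 1 + \sum_(i < K.+1) \sum_(j < K.+1) `|invmx V i j|.
have C0 : 0 < C.
  by rewrite ltr_pwDl // sumr_ge0 // => i _; apply: sumr_ge0.
exists C => // q B eta sq eta0 hq j.
have B0 : 0 <= B by apply: le_trans (hq eta eta0 (lexx _)).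
have [jK|Kj] := ltnP j K.+1; last first.
  by rewrite nth_default ?normr0 ?mul0r ?mulr_ge0 ?(ltW C0) // (leq_trans sq).
pose c : 'rV[R]_K.+1 := \row_i (q`_i * eta ^+ i).
have cV l : (c *m V) ord0 l = q.[eta * a ord0 l].
  rewrite mxE (horner_coef_wide _ sq); apply: eq_bigr => i _.
  by rewrite /V [Vandermonde _ _ _ _]mxE mxE exprMn mulrA.
have -> : `|q`_j| * eta ^+ j = `|c ord0 (Ordinal jK)|.
  by rewrite mxE normrM [X in _ = _ * X]ger0_norm // exprn_ge0 ?ltW.
rewrite -[c](mulmxK Vu) mxE (le_trans (ler_norm_sum _ _ _)) //.
apply: (@le_trans _ _ (\sum_(i < K.+1) `|invmx V i (Ordinal jK)| * B)).
  apply: ler_sum => i _; rewrite normrM mulrC ler_wpM2l // cV hq //.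
    by rewrite mulr_gt0 // a0.
  by rewrite ler_piMr ?a1 // ltW.
rewrite -mulr_suml ler_wpM2r // /C -[leLHS]add0r lerD // ler_sum // => i _.
by rewrite (bigD1 (Ordinal jK)) //= lerDl sumr_ge0.
Qed.

Lemma size_polyM_le (p q : {poly R}) a b :
  (size p <= a.+1)%N -> (size q <= b.+1)%N -> (size (p * q)%R <= (a + b).+1)%N.
Proof.
move=> pa qb; apply: leq_trans (size_polyMleq _ _) _.
by move: pa qb; move: (size (p : seq R)) (size (q : seq R)) => m n; lia.
Qed.

Lemma size_polyX_le (p : {poly R}) a n :
  (size p <= a.+1)%N -> (size (p ^+ n) <= (a * n).+1)%N.
Proof.
move=> pa; apply: leq_trans (size_poly_exp_leq _ _) _.
by rewrite ltnS leq_mul2r; apply/orP; right; move: pa; move: (size (p : seq R)) => m; lia.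
Qed.

Context {d : nat}.
Local Notation X := 'rV[R]_(d.+1).

(* The great circle through [x] with direction [e], in the rational
   parametrisation s = tan (theta / 2). *)
Definition circle (x e : X) (s : R) : X :=
  (1 + s ^+ 2)^-1 *: ((1 - s ^+ 2) *: x + (2 * s) *: e).

Lemma one_sqr_gt0 (s : R) : 0 < 1 + s ^+ 2.
Proof. by rewrite ltr_pwDl ?sqr_ge0. Qed.

Lemma circle_sphere x e s : sphere d x -> sphere d e -> dot x e = 0 ->
  sphere d (circle x e s).
Proof.
move=> /sphereP xx /sphereP ee xe; apply/sphereP.
rewrite /circle dotZl !dotZr dotDl !dotDr !dotZl !dotZr xx ee (dotC e x) xe.
by have := one_sqr_gt0 s => s0; field; rewrite gt_eqF.
Qed.

Lemma circle_dist x e s : sphere d x -> sphere d e -> dot x e = 0 ->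
  enorm (x - circle x e s) ^+ 2 = 4 * s ^+ 2 / (1 + s ^+ 2).
Proof.
move=> xS eS xe; rewrite enormB_sqr //; last exact: circle_sphere.
rewrite /circle dotZr dotDr !dotZr xe; move/sphereP: xS => ->.
by have := one_sqr_gt0 s => s0; field; rewrite gt_eqF.
Qed.

Lemma circle_dist_le x e s : sphere d x -> sphere d e -> dot x e = 0 -> 0 <= s ->
  enorm (x - circle x e s) <= 2 * s.
Proof.
move=> xS eS xe s0; rewrite -(@ler_sqr _ (enorm _)) ?nnegrE ?enorm_ge0 ?mulr_ge0 //.
rewrite circle_dist // ler_pdivrMr ?one_sqr_gt0 //.
have := sqr_ge0 s; set v := s ^+ 2 => v0.
by rewrite exprMn -/v; nra.
Qed.

Lemma circle_neq x e s : sphere d x -> sphere d e -> dot x e = 0 -> 0 < s ->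
  circle x e s <> x.
Proof.
move=> xS eS xe s0 h; have := circle_dist s xS eS xe; rewrite h subrr.
have -> : enorm (0 : X) ^+ 2 = 0 by rewrite enorm_sqr -{1}(scale0r x) dotZl mul0r.
move/eqP.
by rewrite eq_sym gt_eqF // divr_gt0 ?one_sqr_gt0 // mulr_gt0 // exprn_gt0.
Qed.

Lemma circle_through x y : sphere d x -> sphere d y ->
  -1 < dot x y -> dot x y < 1 ->
  exists e s, [/\ sphere d e, dot x e = 0, 0 < s & y = circle x e s].
Proof.
move=> xS yS; set t := dot x y => tN1 t1.
have t1' : 0 < 1 - t by lra.
have t2' : 0 < 1 + t by lra.
(* [s = tan(a / 2)] for the angle [a] between [x] and [y]; the antipode would need an infinite
   [s]. *)
pose s := Num.sqrt ((1 - t) / (1 + t)).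
have s0 : 0 < s by rewrite sqrtr_gt0 divr_gt0.
have ss : s ^+ 2 = (1 - t) / (1 + t) by rewrite sqr_sqrtr // divr_ge0 ?ltW.
have nz : s * (1 + t) != 0 by rewrite mulf_neq0 // gt_eqF.
exists ((s * (1 + t))^-1 *: (y - t *: x)), s.
move/sphereP: xS => xx; move/sphereP: yS => yy.
split => //.
- apply/sphereP; rewrite dotZl dotZr dotDl !dotDr !dotNl !dotNr !dotZl !dotZr xx yy.
  rewrite (dotC y x) -/t mulrA -expr2 exprVn exprMn ss.
  by field; rewrite !gt_eqF.
- by rewrite dotZr dotDr dotNr dotZr xx mulr1 -/t subrr mulr0.
- rewrite /circle scalerA scalerBr !scalerA scalerDr scalerBr !scalerA addrCA -scalerBl.
  have -> : (1 + s ^+ 2)^-1 * (2 * s * (s * (1 + t))^-1) = 1.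
    by rewrite ss; field; rewrite !gt_eqF //; lra.
  have -> : (1 + s ^+ 2)^-1 * (1 - s ^+ 2) - (1 + s ^+ 2)^-1 * (2 * s * (s * (1 + t))^-1 * t) = 0.
    by rewrite ss; field; rewrite !gt_eqF //; lra.
  by rewrite scale1r scale0r addr0.
Qed.

(** The coordinates of [circle x e s] are quadratics over [1 + s^2], so the power [rho] clears all
    denominators. *)
Lemma poly_on_circle rho (p : X -> R) x e : poly_le rho p ->
  exists q : {poly R}, (size q <= (2 * rho).+1)%N /\
    forall s, q.[s] = (1 + s ^+ 2) ^+ rho * p (circle x e s).
Proof.
move=> [l [hl hp]].
suff [q [sq hq]] : exists q : {poly R}, (size q <= (2 * rho).+1)%N /\
    forall s, q.[s] = \sum_(t <- l) (1 + s ^+ 2) ^+ rho * (t.1 * monomial t.2 (circle x e s)).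
  by exists q; split => // s; rewrite hq hp mulr_sumr.
elim: l hl {hp} => [_|[c a] l IH /= /andP[aN hl]].
  by exists 0; rewrite size_poly0; split => // s; rewrite horner0 big_nil.
have [q [sq hq]] := IH hl.
pose u : {poly R} := 1 + 'X ^+ 2.
pose v i : {poly R} := (1 - 'X ^+ 2) * (x ord0 i)%:P + (2 *: 'X) * (e ord0 i)%:P.
have sX2 : (size ('X ^+ 2 : {poly R}) <= 3)%N by rewrite size_polyXn.
have s1 : (size (1%R : {poly R}) <= 3)%N by rewrite size_poly1.
have su : (size u <= 3)%N by rewrite (leq_trans (size_polyD _ _)) // geq_max s1.
have sv i : (size (v i) <= 3)%N.
  rewrite (leq_trans (size_polyD _ _)) // geq_max; apply/andP; split.
    rewrite (@size_polyM_le _ _ 2 0) ?size_polyC_leq1 //.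
    by rewrite (leq_trans (size_polyD _ _)) // geq_max s1 size_polyN.
  rewrite (@size_polyM_le _ _ 2 0) ?size_polyC_leq1 //.
  by rewrite (leq_trans (size_scale_leq _ _)) // size_polyX.
pose m : {poly R} := \prod_(i < d.+1) v i ^+ a i.
have sm : (size m <= (2 * mdeg a).+1)%N.
  rewrite /m /mdeg; elim/big_ind2: _ => [|a1 p1 a2 p2 h1 h2|i _].
  - by rewrite size_poly1.
  - by rewrite mulnDr size_polyM_le.
  - exact: size_polyX_le.
exists (c *: (u ^+ (rho - mdeg a) * m) + q); split.
  rewrite (leq_trans (size_polyD _ _)) // geq_max sq andbT.
  rewrite (leq_trans (size_scale_leq _ _)) //.
  have h := size_polyM_le (size_polyX_le (rho - mdeg a) su) sm.
  by apply: leq_trans h _; rewrite -mulnDr subnK.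
move=> s; rewrite big_cons hornerD hq; congr (_ + _).
rewrite hornerZ hornerM horner_exp /m horner_prod.
set w := 1 + s ^+ 2; have w0 : w != 0 by rewrite gt_eqF // one_sqr_gt0.
have -> : u.[s] = w by rewrite /u !hornerE.
have -> : \prod_(i < d.+1) (v i ^+ a i).[s] = w ^+ mdeg a * monomial a (circle x e s).
  rewrite /mdeg -prodrXr /monomial -big_split /=; apply: eq_bigr => i _.
  rewrite horner_exp -exprMn; congr (_ ^+ _).
  by rewrite /v !hornerE !mxE -/w; field.
have -> : w ^+ rho = w ^+ (rho - mdeg a) * w ^+ mdeg a by rewrite -exprD subnK.
rewrite /=; ring.
Qed.

End Growth.

(** On the great circle through [x] and [y], the bound near [x] controls the coefficients in [s].
    Because [|x - y|^2 = 4 s^2 / (1 + s^2)], the factor [(1 + s^2)^rho] cancels, so [C] depends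
    neither on [d] nor on closeness to the antipode. *)
Lemma poly_growth (R : realType) rho : exists2 C : R, 0 < C &
  forall (d : nat) (p : 'rV[R]_(d.+1) -> R) (x y : 'rV[R]_(d.+1)) (B eta : R),
  poly_le rho p -> sphere d x -> sphere d y -> -1 < dot x y ->
  0 < eta -> eta <= 1 -> eta < enorm (x - y) ->
  (forall z, sphere d z -> z <> x -> enorm (x - z) <= eta -> `|p z| <= B) ->
  `|p y| * eta ^+ (2 * rho) <= C * B * enorm (x - y) ^+ (2 * rho).
Proof.
have [C C0 hC] := @poly_coef_bound R (2 * rho).
(* [(2 * rho).+1] counts the coefficients, and [2^rho] bounds [(1 + s^2)^rho] for [s <= 1/2]. *)
exists ((2 * rho).+1%:R * C * 2 ^+ rho); first by rewrite !mulr_gt0 ?exprn_gt0 ?ltr0n.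
move=> d p x y B eta hp xS yS txy eta0 eta1 etay hB.
have t1 : dot x y < 1.
  have : 0 < enorm (x - y) ^+ 2 by rewrite exprn_gt0 // (lt_trans eta0).
  by rewrite enormB_sqr //; lra.
have [e [s [eS xe s0 ye]]] := circle_through xS yS txy t1.
have [q [sq hq]] := poly_on_circle x e hp.
have eta20 : 0 < eta / 2 by rewrite divr_gt0.
have hqB z : 0 < z -> z <= eta / 2 -> `|q.[z]| <= 2 ^+ rho * B.
  move=> z0 z1; rewrite hq normrM normrX (gtr0_norm (one_sqr_gt0 z)).
  have z1p := one_sqr_gt0 z; apply: ler_pM; rewrite ?exprn_ge0 ?(ltW z1p) //.
    apply: lerXn2r; rewrite ?nnegrE ?(ltW z1p) //.
    have z2 : z <= 2^-1 by rewrite (le_trans z1) // ler_piMl ?invr_ge0.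
    by have := sqr_ge0 z; rewrite expr2; nra.
  apply: hB; [exact: circle_sphere|exact: circle_neq|].
  rewrite (le_trans (circle_dist_le xS eS xe (ltW z0))) //.
  by rewrite mulrC -ler_pdivlMr.
have hc := hC q _ _ sq eta20 hqB.
set K := (2 * rho)%N in hc sq *.
(* Here [eta < |x - y| <= 2 s], so the top power of [s / (eta / 2)] dominates the lower ones. *)
have se : 1 <= s / (eta / 2).
  rewrite ler_pdivlMr // mul1r ltW // -(ltr_pM2l (ltr0Sn R 1)) mulrC divfK //.
  rewrite (lt_le_trans etay) // ye; exact: circle_dist_le (ltW s0).
pose w := 1 + s ^+ 2; have w0 : 0 < w := one_sqr_gt0 s.
have D2 : enorm (x - y) ^+ K = (2 * s) ^+ K / w ^+ rho.
  by rewrite /K !exprM ye circle_dist // expr_div_n; congr (_ ^+ _ / _); ring.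
rewrite D2 mulrA ler_pdivlMr ?exprn_gt0 // mulrAC.
have -> : `|p y| * w ^+ rho = `|q.[s]|.
  by rewrite hq -ye normrM normrX (gtr0_norm w0) mulrC.
have -> : eta ^+ K = 2 ^+ K * (eta / 2) ^+ K by rewrite -exprMn mulrC divfK.
rewrite mulrCA (_ : _ * (2 * s) ^+ K = 2 ^+ K * (K.+1%:R * C * 2 ^+ rho * B * s ^+ K));
  last by rewrite exprMn; ring.
rewrite ler_pM2l ?exprn_gt0 //.
rewrite -ler_pdivlMr ?exprn_gt0 // (_ : _ / _ = K.+1%:R * C * 2 ^+ rho * B * (s / (eta / 2)) ^+ K);
  last by rewrite [in RHS]expr_div_n mulrA.
rewrite (horner_coef_wide s sq) (le_trans (ler_norm_sum _ _ _)) //.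
apply: (@le_trans _ _ (\sum_(i < K.+1) C * (2 ^+ rho * B) * (s / (eta / 2)) ^+ K)).
  apply: ler_sum => i _; rewrite normrM normrX (gtr0_norm s0).
  apply: (@le_trans _ _ (C * (2 ^+ rho * B) * (s / (eta / 2)) ^+ i)).
    rewrite expr_div_n (mulrA _ (s ^+ i)) ler_pdivlMr ?exprn_gt0 // mulrAC ler_wpM2r //.
    by rewrite exprn_ge0 // ltW.
  have CB : 0 <= C * (2 ^+ rho * B).
    by apply: le_trans (hc 0%N); rewrite mulr_ge0 // exprn_ge0 // ltW.
  by rewrite ler_wpM2l // ler_weXn2l // -ltnS.
rewrite sumr_const card_ord -mulr_natl; rewrite le_eqVlt; apply/orP; left; apply/eqP; ring.
Qed.

(** * Binomial estimates for dimensions and their ratios *)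

Lemma ffact_le_exp n m : (n ^_ m <= n ^ m)%N.
Proof.
elim: m => [|m IH]; first by rewrite ffactn0.
by rewrite ffactnSr expnSr leq_mul // leq_subr.
Qed.

Lemma exp_le_ffact d j : (d ^ j <= (d + j) ^_ j)%N.
Proof.
elim: j => [|j IH]; first by rewrite ffactn0.
by rewrite addnS ffactSS expnS leq_mul // leqW // leq_addr.
Qed.

Lemma bin_le_exp2 n m : ('C(n, m) <= 2 ^ n)%N.
Proof.
elim: n m => [[|m]|n IH [|m]]; rewrite ?bin0 ?expn_gt0 //.
by rewrite binS expnS mul2n -addnn leq_add.
Qed.

(** From [d^d <= (2d)!/d! = C(2d, d) d!] and [C(2d, d) <= 2^(2d)]. *)
Lemma exp_le_fact d : (d ^ d <= 4 ^ d * d`!)%N.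
Proof.
apply: leq_trans (exp_le_ffact d d) _.
by rewrite -bin_ffact leq_mul // (leq_trans (bin_le_exp2 _ _)) // addnn -mul2n expnM.
Qed.

Lemma bin_exp_le d L : ('C(d + L, d) * d ^ d <= (4 * (d + L)) ^ d)%N.
Proof.
apply: (@leq_trans ('C(d + L, d) * (4 ^ d * d`!))); first by rewrite leq_mul // exp_le_fact.
by rewrite mulnCA bin_ffact expnMn leq_mul // ffact_le_exp.
Qed.

(** The quotient of the binomials is a product of [d] factors [(N + i)/(M + i)], each at most
    [N/M]. *)
Lemma bin_ratio d M N : (M <= N)%N ->
  ('C(d + N, d) * M ^ d <= 'C(d + M, d) * N ^ d)%N.
Proof.
move=> MN; elim: d => [|d IH]; first by rewrite !bin0.
rewrite -(leq_pmul2l (ltn0Sn d)) !mulnA -!mul_bin_diag /= !expnS.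
have h : ((d + N).+1 * M <= (d + M).+1 * N)%N by nia.
have := leq_mul h IH; rewrite !addSn.
by rewrite -!mulnA (mulnCA M) (mulnCA N).
Qed.

(** The ratio is at most [(N/M)^d <= (1 + a/d)^d <= expR a]. *)
Lemma bin_ratio_expR (R : realType) d M N (a : R) : (M <= N)%N ->
  d%:R * (N%:R - M%:R) <= a * M%:R -> (0 < M)%N ->
  'C(d + N, d)%:R <= expR a * 'C(d + M, d)%:R :> R.
Proof.
move=> MN h M0; have M0' : 0 < M%:R :> R by rewrite ltr0n.
have [d0|d0] := posnP d.
  rewrite d0 !bin0 mulr1; apply: le_trans (expR_ge1Dx _).
  by rewrite lerDl -(pmulr_lge0 _ M0') (le_trans _ h) // d0 mul0r.
have d0' : 0 < d%:R :> R by rewrite ltr0n.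
rewrite -(ler_pM2r (x := M%:R ^+ d)) ?exprn_gt0 //.
apply: (@le_trans _ _ ('C(d + M, d)%:R * N%:R ^+ d)).
  by rewrite -!natrX -!natrM ler_nat bin_ratio.
have -> : expR a = expR (a / d%:R) ^+ d.
  by rewrite -expRM_natl mulrC divfK // gt_eqF.
rewrite mulrAC mulrC ler_wpM2r // -exprMn.
apply: lerXn2r; rewrite ?nnegrE ?mulr_ge0 ?expR_ge0 //.
apply: le_trans (ler_wpM2r (ltW M0') (expR_ge1Dx _)).
rewrite -(ler_pM2l d0') mulrA mulrDr mulr1 mulrCA divff ?gt_eqF // mulr1 mulrDl.
by move: h; rewrite mulrBr; lra.
Qed.

(** * Local polynomials at their centre *)

Section LocalData.
Context {R : realType} {d : nat}.
Local Notation X := 'rV[R]_(d.+1).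

Lemma exists_orthogonal (x : X) : (0 < d)%N -> exists2 e, sphere d e & dot x e = 0.
Proof.
move=> d0; have [v v0 vx] := left_kernel_neq0 (x^T) (d0 : (1 < d.+1)%N).
have xv : dot x v = 0.
  move/rowP/(_ ord0): vx; rewrite !mxE => vx; rewrite -[RHS]vx.
  by apply: eq_bigr => i _; rewrite mxE mulrC.
have vv : 0 < dot v v.
  by rewrite lt_neqAle dot_ge0 eq_sym andbT; apply: contra_neq v0; exact: dot_eq0.
exists ((Num.sqrt (dot v v))^-1 *: v); last by rewrite dotZr xv mulr0.
apply/sphereP; rewrite dotZl dotZr mulrA -expr2 exprVn sqr_sqrtr ?dot_ge0 //.
by rewrite mulVf ?gt_eqF.
Qed.

Lemma coord_le_enorm (x : X) i : `|x ord0 i| <= enorm x.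
Proof.
rewrite -(@ler_sqr _ `|_|) ?nnegrE ?enorm_ge0 // real_normK ?num_real // enorm_sqr.
rewrite /dot (bigD1 i) //= -expr2 lerDl.
by apply: sumr_ge0 => j _; rewrite -expr2 sqr_ge0.
Qed.

Lemma exists_near (x : X) (u : R) : (0 < d)%N -> sphere d x -> 0 < u ->
  exists y, [/\ sphere d y, y <> x & enorm (x - y) <= u].
Proof.
move=> d0 xS u0; have [e eS xe] := exists_orthogonal x d0.
have u20 : 0 < u / 2 by rewrite divr_gt0.
exists (circle x e (u / 2)); split.
- exact: circle_sphere.
- exact: circle_neq.
- by rewrite (le_trans (circle_dist_le xS eS xe (ltW u20))) // mulrC divfK.
Qed.

Lemma continuous_poly_le N (p : X -> R) : poly_le N p -> continuous p.
Proof.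
move=> [s [_ hp]].
have -> : p = (fun x => \sum_(t <- s) t.1 * monomial t.2 x) by apply/funext.
apply: continuous_sum => t; apply: continuous_mul; first exact: cst_continuous.
apply: continuous_prod => i.
suff h k : continuous (fun x : X => x ord0 i ^+ k) by exact: h.
elim: k => [|k IH].
  by under eq_fun do rewrite expr0; exact: cst_continuous.
under eq_fun do rewrite exprS.
by apply: continuous_mul => //; exact: coord_continuous.
Qed.

(** The local error says nothing at [y = x]; the equality there follows by continuity, since the
    bound tends to 0 along points of the sphere approaching [x]. *)
Lemma local_poly_center (r delta W : R) (f p : X -> R) (x : X) N :
  (0 < d)%N -> 0 < r -> 0 < delta -> 0 <= W -> sphere d x ->
  {within sphere d, continuous f} -> poly_le N p ->
  (forall y, sphere d y -> y <> x -> enorm (x - y) <= delta ->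
     `|f y - p y| <= W * enorm (x - y) `^ r) ->
  f x = p x.
Proof.
move=> d0 r0 delta0 W0 xS /subspace_continuousP/(_ x xS) fc hp hfp.
have pc : p z @[z --> within (sphere d) (nbhs x)] --> p x.
  by apply: cvg_within_filter; exact: (continuous_poly_le hp).
apply/eqP; rewrite -subr_eq0 -normr_le0 leNgt; apply/negP => gap.
set g := `|f x - p x| in gap.
have g20 : 0 < g / 2 by rewrite divr_gt0.
have fc' : f z @[z --> within (sphere d) (nbhs x)] --> f x := fc.
have hF : Filter (within (sphere d) (nbhs x)) by exact: within_filter.
have hc := cvgB fc' pc.
have := (cvgrPdist_lt _ _).1 (hc hF) _ g20; rewrite near_withinE => hn.
have [e /= e0 he] := (nbhs_ballP x _).1 (hn hF).
pose c := (g / 2 / (W + 1)).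
have W1 : 0 < W + 1 by rewrite ltr_pwDr.
have c0 : 0 < c by rewrite divr_gt0.
(* The three constraints put [y] in the continuity neighbourhood and in the ball of radius [delta],
   and make [W |x - y|^r] at most [g / 2]. *)
pose u := Num.min (e / 2) (Num.min delta (c `^ r^-1)).
have u0 : 0 < u by rewrite !lt_min delta0 powR_gt0 // divr_gt0.
have [y [yS yx hy]] := exists_near d0 xS u0.
have hye : enorm (x - y) <= e / 2 by rewrite (le_trans hy) // ge_min lexx.
have hyd : enorm (x - y) <= delta by rewrite (le_trans hy) // !ge_min lexx orbT.
have hyc : enorm (x - y) <= c `^ r^-1 by rewrite (le_trans hy) // !ge_min lexx !orbT.
have hlt : `|(f x - p x) - (f y - p y)| < g / 2.
  apply: he yS; split => // i j; rewrite (ord1 i) /ball /=.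
  have := coord_le_enorm (x - y) j; rewrite !mxE => h.
  by rewrite (le_lt_trans h) // (le_lt_trans hye) // ltr_pdivrMr // ltr_pMr // ltr1n.
have h1 := hfp y yS yx hyd.
have h2 : enorm (x - y) `^ r <= c.
  have -> : c = (c `^ r^-1) `^ r by rewrite -powRrM mulVf ?gt_eqF // powRr1 // ltW.
  by apply: ge0_ler_powR; rewrite ?nnegrE ?enorm_ge0 ?powR_ge0 // ltW.
have h3 : `|f y - p y| <= g / 2.
  apply: (le_trans h1); apply: (@le_trans _ _ (W * c)); first by rewrite ler_wpM2l.
  by rewrite /c mulrA ler_pdivrMr // mulrC ler_pM2l // lerDl.
have : g < g / 2 + g / 2.
  rewrite {1}/g -[f x - p x](subrK (f y - p y)).
  apply: le_lt_trans (ler_normD _ _) _.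
  exact: ltr_leD hlt h3.
by rewrite -splitr ltxx.
Qed.

End LocalData.

(** * Pointwise estimate of the localised error *)

Lemma ln_ge_half (R : realType) (n : R) : 8 <= n -> 1 / 2 <= ln n.
Proof.
move=> n8; have n0 : 0 < n by lra.
have i0 : 0 < n^-1 by rewrite invr_gt0.
have i1 : n^-1 <= 8^-1 by rewrite lef_pV2 ?posrE //; lra.
have h : -1 < n^-1 - 1 by lra.
have := le_ln1Dx h; rewrite addrC subrK lnV ?posrE //.
by lra.
Qed.

(** The condition on [delta] is used in this form: [ln n >= 1/2] turns it into
    [delta^2 n >= 8 r]. *)
Lemma eta_sqr_ge (R : realType) (r n delta : R) : 0 < r -> 8 <= n -> 0 < delta ->
  Num.sqrt (16 * r * ln n / n) <= delta ->
  Num.min 1 (8 * r) <= Num.min delta 1 ^+ 2 * n.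
Proof.
move=> r0 n8 delta0 hd; have n0 : 0 < n by lra.
have ln0 := ln_ge_half n8.
have [dl|dl] := leP delta 1; last by rewrite expr1n mul1r ge_min; apply/orP; left; lra.
have h0 : 0 <= 16 * r * ln n / n.
  by rewrite divr_ge0 ?mulr_ge0 ?(ltW r0) ?(ltW n0) //; lra.
have h : 16 * r * ln n / n <= delta ^+ 2.
  by rewrite -(sqr_sqrtr h0) ler_sqr ?nnegrE ?sqrtr_ge0 // ltW.
rewrite ge_min; apply/orP; right.
rewrite -ler_pdivrMr //; apply: le_trans h; rewrite ler_pM2r ?invr_gt0 //.
by nra.
Qed.

Lemma powR_le1 (R : realType) (a r : R) : 0 <= a -> a <= 1 -> 0 <= r -> a `^ r <= 1.
Proof.
move=> a0 a1 r0; have e : 1 `^ r = 1 :> R by rewrite powR1.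
by rewrite -[leRHS]e; apply: ge0_ler_powR; rewrite ?nnegrE.
Qed.

(* Near x the decay of the bump beats |x - z|^r; far from x it beats the
   polynomial growth of p, the loss being controlled by eta^2 n >= c_r. *)
Lemma pointwise_bound (R : realType) (r : R) (rho : nat) : 0 < r -> r <= rho%:R ->
  exists2 C : R, 0 < C &
  forall (d L : nat) (n delta W : R) (f p : 'rV[R]_(d.+1) -> R) (x z : 'rV[R]_(d.+1)),
  8 <= n -> 0 < delta -> Num.sqrt (16 * r * ln n / n) <= delta ->
  n <= (2 * (2 * rho)%:R) * (2 * L + 1)%:R -> 0 <= W ->
  sphere d x -> sphere d z -> poly_le rho p -> f x = p x ->
  (forall y, sphere d y -> `|f y| <= W) ->
  (forall y, sphere d y -> y <> x -> enorm (x - y) <= delta ->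
     `|f y - p y| <= W * enorm (x - y) `^ r) ->
  `|bump (2 * rho) L (dot x z)| * `|f z - p z| * n `^ r <= C * W.
Proof.
move=> r0 rrho; have [G G0 growth] := @poly_growth R rho.
set s := (2 * rho)%N.
have rho0 : (0 < rho)%N by rewrite -(ltr_nat R); exact: lt_le_trans r0 rrho.
have s0 : (0 < s)%N by rewrite muln_gt0.
pose c1 : R := Num.min 1 (8 * r).
have c10 : 0 < c1 by rewrite lt_min ltr01 /= mulr_gt0.
pose K : R := (4 * s%:R) ^+ s.
have K1 : 1 <= K.
  have : 1 <= s%:R :> R by rewrite ler1n.
  by move=> s1; rewrite exprn_ege1 //; lra.
have K0 : 0 < K by exact: lt_le_trans K1.
exists (K * (1 + (G * 2 + 1) / c1 ^+ rho)).
  by rewrite mulr_gt0 // addr_gt0 // divr_gt0 ?exprn_gt0 // addr_gt0 // mulr_gt0.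
move=> d L n delta W f p x z n8 delta0 hd nL W0 xS zS hp fx fW loc.
have n0 : 0 < n by lra.
have KW : K * W <= K * (1 + (G * 2 + 1) / c1 ^+ rho) * W.
  rewrite ler_wpM2r // ler_peMr ?(ltW K0) // lerDl divr_ge0 ?exprn_ge0 ?(ltW c10) //.
  by rewrite addr_ge0 // mulr_ge0 // ltW.
have [->|zx] := eqVneq z x.
  by rewrite fx subrr normr0 mulr0 mul0r (le_trans _ KW) // mulr_ge0 // ltW.
move/eqP: zx => zx.
have b1 := bump_le1 xS zS s L.
have bd : `|bump s L (dot x z)| * (n * enorm (x - z)) ^+ s <= K.
  by apply: bump_decay => //; exact: ltW.
set b := `|bump s L (dot x z)| in b1 bd *.
have b0 : 0 <= b by rewrite normr_ge0.
set D := enorm (x - z) in bd *.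
have D0 : 0 <= D := enorm_ge0 _.
set eta := Num.min delta 1.
have eta0 : 0 < eta by rewrite lt_min delta0 ltr01.
have eta1 : eta <= 1 by rewrite ge_min lexx orbT.
have etad : eta <= delta by rewrite ge_min lexx.
(* In the near case either [n D <= 1], or the decay exponent [s >= r] absorbs [(n D)^r]. *)
have [near|far] := leP D eta.
  have h : b * (n * D) `^ r <= K.
    have [nD|nD] := leP (n * D) 1.
      apply: le_trans K1; rewrite mulr_ile1 ?powR_ge0 //.
      by rewrite powR_le1 ?mulr_ge0 // ltW.
    apply: le_trans bd; rewrite ler_wpM2l // -powR_mulrn ?mulr_ge0 // ?(ltW n0) //.
    apply: ler_powR; first exact: ltW.
    by rewrite (le_trans rrho) // ler_nat leq_pmull.
  apply: le_trans KW; rewrite powRM ?(ltW n0) // in h.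
  have := loc z zS zx (le_trans near etad); rewrite -/D => hl.
  apply: (@le_trans _ _ (b * (W * D `^ r) * n `^ r)).
    by rewrite ler_wpM2r ?powR_ge0 // ler_wpM2l.
  rewrite (_ : b * (W * D `^ r) * n `^ r = b * (n `^ r * D `^ r) * W); last ring.
  by rewrite ler_wpM2r.
have [t1|] := ltP (-1) (dot x z); last first.
  move=> tm; have e : dot x z = -1 by apply/eqP; rewrite eq_le tm dot_geN1.
  rewrite /b /bump e subrr mul0r mulr0 normr0 !mul0r (le_trans _ KW) //.
  by rewrite mulr_ge0 // ltW.
(* On the punctured ball of radius [eta <= 1], [|p| <= |f| + |f - p| <= 2 W]. *)
have hP : `|p z| * eta ^+ s <= G * (2 * W) * D ^+ s.
  apply: growth => // y yS yx yeta.
  have yd : enorm (x - y) <= delta by exact: le_trans yeta etad.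
  rewrite -[p y](subrK (f y)) (le_trans (ler_normD _ _)) // distrC.
  rewrite (_ : 2 * W = W + W); last ring.
  apply: lerD; last exact: fW.
  apply: le_trans (loc y yS yx yd) _; rewrite ler_piMr //.
  by rewrite powR_le1 ?enorm_ge0 ?(ltW r0) ?(le_trans yeta eta1).
have es0 : 0 < eta ^+ s by rewrite exprn_gt0.
have hfp : `|f z - p z| * eta ^+ s <= (G * 2 + 1) * W * D ^+ s.
  apply: (@le_trans _ _ ((`|f z| + `|p z|) * eta ^+ s)).
    by rewrite ler_wpM2r ?(ltW es0) // ler_normB.
  rewrite mulrDl addrC (_ : (G * 2 + 1) * W * D ^+ s = G * (2 * W) * D ^+ s + W * D ^+ s); last ring.
  apply: lerD => //; apply: ler_pM; rewrite ?normr_ge0 ?(ltW es0) ?fW //.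
  by apply: lerXn2r; rewrite ?nnegrE ?(ltW eta0) // ltW.
(* Of the [2 rho] powers of [n], half pay for [eta^(2 rho)] through [eta^2 n >= c1], and the other
   half give [n^rho >= n^r]. *)
have en : c1 ^+ rho * n `^ r <= eta ^+ s * n ^+ s.
  have h := eta_sqr_ge r0 n8 delta0 hd.
  rewrite /s -exprMn exprM (_ : (eta * n) ^+ 2 = eta ^+ 2 * n * n); last ring.
  apply: (@le_trans _ _ (c1 ^+ rho * n ^+ rho)).
    rewrite ler_wpM2l ?exprn_ge0 ?(ltW c10) // -powR_mulrn ?(ltW n0) //.
    by apply: ler_powR => //; lra.
  have en0 : 0 <= eta ^+ 2 * n := le_trans (ltW c10) h.
  rewrite -exprMn; apply: lerXn2r; rewrite ?nnegrE ?ler_pM2r //.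
    exact: mulr_ge0 (ltW c10) (ltW n0).
  exact: mulr_ge0 en0 (ltW n0).
have cr0 : 0 < c1 ^+ rho by rewrite exprn_gt0.
have GW : 0 <= (G * 2 + 1) * W.
  by rewrite mulr_ge0 // addr_ge0 // mulr_ge0 // ltW.
have key : b * `|f z - p z| * (c1 ^+ rho * n `^ r) <= K * (G * 2 + 1) * W.
  apply: (@le_trans _ _ (b * `|f z - p z| * (eta ^+ s * n ^+ s))).
    by rewrite ler_wpM2l // mulr_ge0.
  rewrite (_ : _ * _ = (`|f z - p z| * eta ^+ s) * (b * n ^+ s)); last ring.
  apply: (@le_trans _ _ ((G * 2 + 1) * W * D ^+ s * (b * n ^+ s))).
    by rewrite ler_wpM2r // mulr_ge0 // exprn_ge0 // ltW.
  rewrite (_ : (G * 2 + 1) * W * D ^+ s * (b * n ^+ s) = (b * (n * D) ^+ s) * ((G * 2 + 1) * W)); last by rewrite exprMn; ring.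
  by rewrite -[leRHS]mulrA ler_wpM2r.
rewrite -(@ler_pM2l R (c1 ^+ rho) cr0).
rewrite (_ : c1 ^+ rho * (b * `|f z - p z| * n `^ r) = b * `|f z - p z| * (c1 ^+ rho * n `^ r)); last ring.
apply: le_trans key _.
rewrite (_ : c1 ^+ rho * _ = c1 ^+ rho * K * W + K * (G * 2 + 1) * W); last by field; rewrite gt_eqF.
by rewrite lerDr !mulr_ge0 // ltW.
Qed.

(** * A reproducing operator with bounded absolute sums *)

Lemma reproducing_operator (R : realType) (d M T : nat) (a : R) :
  (0 < M)%N -> d.+1%:R * T%:R <= a * M%:R ->
  exists (P : nat) (y : 'I_P -> 'rV[R]_(d.+2)) (psi : 'I_P -> 'rV[R]_(d.+2) -> R),
  [/\ forall i, sphere d.+1 (y i),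
      forall i, poly_le (2 * M + T) (psi i),
      forall x, sphere d.+1 x -> \sum_i `|psi i x| <= expR a + 1 &
      forall h x, poly_le T h -> sphere d.+1 x -> \sum_i psi i x * h (y i) = h x].
Proof.
move=> M0 aM; set N := (M + T)%N.
(* Degree [2 N] covers products of two polynomials of degree [N]. *)
have [P [w [y [wy invar]]]] := @exists_invariant_design R d.+1 (N + N).
have [w0 _ yS] := wy.
have MN : (M + M <= N + N)%N by rewrite leq_add ?leq_addr.
have [kN [bN [oN basisN]]] := exists_orthonormal_basis wy invar (leqnn (N + N)).
have [kM [bM [oM basisM]]] := exists_orthonormal_basis wy invar MN.
have hN : (kN <= 2 * 'C(d.+1 + N, d.+1))%N.
  by apply: indep_size_le (orthonormal_indep wy oN) _; case: oN.
have hM : ('C(d.+1 + M, d.+1) <= kM)%N.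
  by apply: (@basis_size_ge R d M kM bM) => p hp; exists (fun i => ip w y p (bM i)) => x; exact: basisM.
have kM0 : 0 < kM%:R :> R by rewrite ltr0n (leq_trans _ hM) // bin_gt0 leq_addr.
(* With this ratio the mean [(kN + kM) / (2 kM)] is at most [expR a + 1/2]. *)
have ratio : kN%:R <= 2 * expR a * kM%:R :> R.
  apply: (@le_trans _ _ (2 * 'C(d.+1 + N, d.+1)%:R)); first by rewrite -natrM ler_nat.
  rewrite -mulrA ler_pM2l //.
  apply: (@le_trans _ _ (expR a * 'C(d.+1 + M, d.+1)%:R)).
    by apply: bin_ratio_expR; rewrite ?leq_addr // /N natrD addrAC subrr add0r.
  by rewrite ler_wpM2l ?expR_ge0 // ler_nat.
exists P, y, (fun i x => w i * (kernel bN x (y i) * kernel bM x (y i)) / kM%:R); split => //.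
- move=> i; have h := poly_leM (poly_le_kernel oN (y i)) (poly_le_kernel oM (y i)).
  have -> : (2 * M + T = N + M)%N by rewrite /N; lia.
  apply: poly_le_ext (poly_leZ (w i / kM%:R) h) => x.
  by rewrite (kernelC bN x) (kernelC bM x); ring.
- move=> x xS.
  (* [|K_N K_M| <= (K_N^2 + K_M^2) / 2], whose integral is [(k_N + k_M) / 2] *)
  apply: (@le_trans _ _ (\sum_i w i * (kernel bN x (y i) ^+ 2 + kernel bM x (y i) ^+ 2) / (2 * kM%:R))).
    apply: ler_sum => i _; rewrite normrM normfV (gtr0_norm kM0) normrM (ger0_norm (w0 i)).
    rewrite invfM mulrA ler_wpM2r ?invr_ge0 ?(ltW kM0) // -mulrA ler_wpM2l //.
    rewrite ler_pdivlMr // normrM.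
    have := sqr_ge0 (`|kernel bN x (y i)| - `|kernel bM x (y i)|).
    rewrite -(real_normK (num_real (kernel bN x (y i)))) -(real_normK (num_real (kernel bM x (y i)))).
    by rewrite sqrrB; lra.
  rewrite -mulr_suml ler_pdivrMr ?mulr_gt0 //.
  under eq_bigr do rewrite mulrDr.
  rewrite big_split /=.
  have -> : \sum_i w i * kernel bN x (y i) ^+ 2 = kN%:R.
    rewrite -(kernel_diag wy invar (leqnn _) oN basisN xS).
    by rewrite -(kernel_reproducing basisN (poly_le_kernel oN x) xS).
  have -> : \sum_i w i * kernel bM x (y i) ^+ 2 = kM%:R.
    rewrite -(kernel_diag wy invar MN oM basisM xS).
    by rewrite -(kernel_reproducing basisM (poly_le_kernel oM x) xS).
  by lra.
- move=> h x hh xS.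
  (* [K_M(x, .) h] has degree at most [M + T = N], so [K_N] reproduces its value
     [K_M(x, x) h(x) = kM h(x)]. *)
  have hK : poly_le N (fun z => kernel bM x z * h z) by exact: poly_leM (poly_le_kernel oM x) hh.
  have := kernel_reproducing basisN hK xS.
  rewrite (kernel_diag wy invar MN oM basisM xS) /ip => e.
  apply: (mulfI (lt0r_neq0 kM0)); rewrite -e mulr_sumr; apply: eq_bigr => i _.
  by field; rewrite gt_eqF.
Qed.

(** * Norms, dimension, and assembly of the quasi-interpolant *)

Section Norms.
Context {R : realType} {d : nat}.
Local Notation X := 'rV[R]_(d.+1).
Implicit Types (f : X -> R) (x : X).

Lemma le_supnorm f x : sphere d x -> (`|f x|%:E <= supnorm f)%E.
Proof. by move=> xS; apply: ereal_sup_ubound; exists x. Qed.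

Lemma supnorm_ge0 f : (0 <= supnorm f)%E.
Proof.
have [x xS] := @sphere_nonempty R d.
by apply: le_trans (le_supnorm f xS); rewrite lee_fin.
Qed.

(** A point of the punctured ball keeps the inner supremum away from the value [-oo] of an empty
    set. *)
Lemma loc_err_ge0 r delta f x : (0 < d)%N -> 0 < delta -> sphere d x ->
  (0 <= loc_err r delta f x)%E.
Proof.
move=> d0 delta0 xS; apply: le_ereal_inf_tmp => _ [p _ <-].
have [y [yS yx hy]] := exists_near d0 xS delta0.
apply: (@le_trans _ _ (`|f y - p y| / enorm (x - y) `^ r)%:E).
  by rewrite lee_fin divr_ge0 // powR_ge0.
by apply: ereal_sup_ubound; exists y.
Qed.

(** The infimum over local polynomials is approached within an arbitrary [eps], which is let go at
    the end of the error estimate. *)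
Lemma Wnorm_bounds r delta f W : (0 < d)%N -> 0 < delta -> Wnorm r delta f = W%:E ->
  [/\ 0 <= W, forall x, sphere d x -> `|f x| <= W &
    forall eps x, 0 < eps -> sphere d x -> exists2 p, polyfun d r p &
      forall y, sphere d y -> y <> x -> enorm (x - y) <= delta ->
        `|f y - p y| <= (W + eps) * enorm (x - y) `^ r].
Proof.
move=> d0 delta0 hW.
have hx x : sphere d x -> (supnorm f + loc_err r delta f x <= W%:E)%E.
  by move=> xS; rewrite -hW; apply: ereal_sup_ubound; exists x.
have sW : (supnorm f <= W%:E)%E.
  have [x xS] := @sphere_nonempty R d.
  by apply: le_trans (hx x xS); rewrite leeDl // loc_err_ge0.
split.
- by have := le_trans (supnorm_ge0 f) sW; rewrite lee_fin.
- by move=> x xS; have := le_trans (le_supnorm f xS) sW; rewrite lee_fin.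
- move=> eps x eps0 xS.
  have : (loc_err r delta f x < (W + eps)%:E)%E.
    apply: (@le_lt_trans _ _ W%:E); last by rewrite lte_fin ltrDl.
    by apply: le_trans (hx x xS); rewrite leeDr // supnorm_ge0.
  move=> /ereal_inf_lt[_ [p pr <-] hp]; exists p => // y yS yx yd.
  have xy0 : 0 < enorm (x - y).
    rewrite lt_neqAle enorm_ge0 eq_sym andbT; apply/eqP => /enorm_eq0 e.
    exact/yx.
  rewrite -ler_pdivrMr ?powR_gt0 // -lee_fin; apply: le_trans (ltW hp).
  by apply: ereal_sup_ubound; exists y.
Qed.

Lemma dim_Pi_gt0 (m : R) k : 0 < m -> dim_Pi d m k -> (0 < k)%N.
Proof.
move=> m0 [_ h]; rewrite lt0n; apply/eqP => k0; subst k; apply: h.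
exists (fun _ _ => 1); split => [i|c hc i].
  by apply: (@polyfun_of_poly_le _ _ m 0%N) => //; exact: poly_le_cst.
have [x xS] := @sphere_nonempty R d.
by have := hc x xS; rewrite big_ord1 mulr1 (ord1 i).
Qed.

End Norms.

(** With [D = d + 1] and [L] the integer part of [m], combine [k <= 2 C(D + L, D)] and
    [C(D + L, D) D^D <= (4 (D + L))^D]; the leading 2 is absorbed as [2^D], whence the 8. *)
Lemma dim_Pi_le (R : realType) d (m : R) k : 0 < m -> dim_Pi d.+1 m k ->
  k%:R <= (8 * (1 + m / d.+1%:R)) ^+ d.+1.
Proof.
move=> m0 [[ps [hp hi]] _]; set L := Num.truncn m.
have mL : m <= L.+1%:R by apply/ltW/truncnS_gt.
have Lm : L%:R <= m by rewrite truncn_le ltW.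
have hk : (k <= 2 * 'C(d.+1 + L, d.+1))%N.
  by apply: indep_size_le hi _ => i; exact: poly_le_of_polyfun (hp i).
have hd0 : 0 < d.+1%:R :> R by rewrite ltr0n.
have dd0 : 0 < d.+1%:R ^+ d.+1 :> R by rewrite exprn_gt0.
rewrite -(ler_pM2r dd0) -exprMn.
apply: (@le_trans _ _ (2 * (4 * (d.+1 + L)) ^ d.+1)%:R).
  rewrite -natrX -natrM ler_nat (leq_trans (leq_mul hk (leqnn _))) // -mulnA leq_mul2l.
  exact: bin_exp_le.
rewrite natrM natrX; apply: (@le_trans _ _ (2 ^+ d.+1 * (4 * (d.+1 + L))%:R ^+ d.+1)).
  by rewrite ler_wpM2r ?exprn_ge0 // ler_eXnr // ler1n.
rewrite -exprMn; apply: lerXn2r; rewrite ?nnegrE ?mulr_ge0 ?addr_ge0 ?divr_ge0 ?(ltW m0) //.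
have -> : 8 * (1 + m / d.+1%:R) * d.+1%:R = 8 * (d.+1%:R + m).
  by field; rewrite gt_eqF.
rewrite natrM natrD; lra.
Qed.

(* f - Q = sum_i psi_i(x) bump(x.y_i) (p(y_i) - f(y_i)), because bump * p is
   reproduced by the psi_i and equals p at x. *)
Lemma quasi_interpolation (R : realType) (r : R) (rho : nat) : 0 < r -> r <= rho%:R ->
  exists2 C : R, 0 < C &
  forall (d M L : nat) (n delta : R) (f : 'rV[R]_(d.+2) -> R) (W : R),
  8 <= n -> 0 < delta -> Num.sqrt (16 * r * ln n / n) <= delta ->
  M%:R = d.+1%:R * n -> n <= (2 * (2 * rho)%:R) * (2 * L + 1)%:R ->
  ((2 * rho * L + 1) + rho)%:R <= 2 * n ->
  {within sphere d.+1, continuous f} -> Wnorm r delta f = W%:E ->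
  exists2 Q, poly_le (2 * M + 2 * (2 * rho * L + 1) + rho) Q &
    forall x, sphere d.+1 x -> `|f x - Q x| * n `^ r <= C * W.
Proof.
move=> r0 rrho; have [C C0 pointwise] := pointwise_bound r0 rrho.
exists ((expR 2 + 1) * C); first by rewrite mulr_gt0 // addr_gt0 // expR_gt0.
move=> d M L n delta f W n8 delta0 hd Mn nL Tn fc hW.
have n0 : 0 < n by lra.
have M0 : (0 < M)%N by rewrite -(ltr_nat R) Mn mulr_gt0 // ltr0n.
set S := (2 * rho * L + 1)%N in Tn *.
have aM : d.+1%:R * (S + rho)%:R <= 2 * M%:R :> R.
  by rewrite Mn mulrCA ler_pM2l ?ltr0n.
have [P [y [psi [yS psiN psi1 psih]]]] := reproducing_operator M0 aM.
have [W0 fW loc] := Wnorm_bounds (ltn0Sn d) delta0 hW.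
pose u (x z : 'rV[R]_(d.+2)) : R := bump (2 * rho) L (dot x z).
exists (fun x => \sum_i f (y i) * (psi i x * u x (y i))).
  apply: poly_le_sum => i; apply: poly_leZ.
  apply: poly_leW (poly_leM (psiN i) (poly_le_bump (2 * rho) L (y i))).
  by rewrite -/S; lia.
move=> x xS; apply/ler_addgt0Pr => e e0.
(* Scaled so that the excess [eps] contributes exactly [e] to the final bound. *)
pose eps := e / ((expR 2 + 1) * C).
have E0 : 0 < (expR 2 + 1) * C by rewrite mulr_gt0 // addr_gt0 // expR_gt0.
have eps0 : 0 < eps by rewrite divr_gt0.
have -> : (expR 2 + 1) * C * W + e = (expR 2 + 1) * (C * (W + eps)).
  by rewrite /eps; field; rewrite gt_eqF ?gt_eqF // addr_gt0 // expR_gt0.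
have [p pr ploc] := loc eps x eps0 xS.
have prho : poly_le rho p.
  apply: poly_le_of_polyfun pr; apply: le_trans rrho _; by rewrite ler_nat leqnSn.
have We0 : 0 <= W + eps by rewrite addr_ge0 // ltW.
have fx : f x = p x by exact: (local_poly_center (ltn0Sn d) r0 delta0 We0 xS fc prho ploc).
have hT : poly_le (S + rho) (fun z => u x z * p z).
  apply: poly_leM prho; apply: poly_le_ext (poly_le_bump (2 * rho) L x) => z.
  by rewrite /u dotC.
have ux : u x x = 1 by rewrite /u; move/sphereP: xS => ->; exact: bump1.
have -> : f x - \sum_i f (y i) * (psi i x * u x (y i)) =
    \sum_i psi i x * (u x (y i) * (p (y i) - f (y i))).
  rewrite fx -[p x]mul1r -ux -(psih _ _ hT xS) -sumrB; apply: eq_bigr => i _; ring.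
apply: (@le_trans _ _ (\sum_i `|psi i x| * (C * (W + eps)))).
  apply: (le_trans (ler_wpM2r (powR_ge0 _ _) (ler_norm_sum _ _ _))).
  rewrite mulr_suml; apply: ler_sum => i _.
  rewrite normrM -mulrA ler_wpM2l // normrM distrC.
  apply: (pointwise d.+1 L n delta) => // z zS.
  by rewrite (le_trans (fW z zS)) // lerDl ltW.
by rewrite -mulr_suml ler_wpM2r ?psi1 // mulr_ge0 // ltW.
Qed.

Unset Implicit Arguments.

(* Ambient space R^{d+1} is written 'rV_(d.+1) with d : nat (so d.+1 = d+1). *)
Theorem theorem5p2 (R : realType) (r : R) :
  0 < r ->
  exists c : R, 0 < c /\
  forall (d : nat) (n delta : R) (f : 'rV[R]_(d.+1) -> R) (k : nat),
    (3 <= d)%N ->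
    2 * (d%:R + 1) <= n ->
    (exists N : nat, d%:R * n = N%:R) ->
    {within sphere d, continuous f} ->
    0 < delta ->
    (Wnorm r delta f < +oo)%E ->
    (d%:R + r + 1) ^+ 2 <= d%:R * n ->
    Num.sqrt (16 * r * ln n / n) <= delta ->
    dim_Pi d (2 * (d%:R + 2) * n) k ->
    (Ebest (2 * (d%:R + 2) * n) f
       <= (c * (d%:R `^ (6^-1)) / (k%:R `^ (r / d%:R)))%:E * Wnorm r delta f)%E.
Proof.
(* Polynomials of degree below [r] have degree at most the integer [rho], while [rho <= r + 1] keeps
   the total degree under control. *)
move=> r0; have [rho rrho rhor] : exists2 rho : nat, r <= rho%:R & rho%:R <= r + 1.
  exists (Num.truncn r).+1; first by apply/ltW/truncnS_gt.
  by rewrite -natr1 lerD2r truncn_le ltW.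
have rho0 : (0 < rho)%N by rewrite -(ltr_nat R) (lt_le_trans r0).
have [C C0 approx] := quasi_interpolation r0 rrho.
(* [C] comes from the approximation and [32^r] from the bound [k^(1/d) <= 32 n]. *)
exists (C * 32 `^ r); split; first by rewrite mulr_gt0 // powR_gt0.
move=> [//|d] n delta f k d3 dn [M hM] fc delta0 Wfin rn hd hk.
set s := (2 * rho)%N; set m := 2 * (d.+1%:R + 2) * n.
have hd3 : 3 <= d.+1%:R :> R by rewrite ler_nat.
have n8 : 8 <= n by lra.
have n0 : 0 < n by lra.
have m0 : 0 < m by rewrite mulr_gt0 // mulr_gt0 //; lra.
(* With [D = d.+1], [(D + r + 1)^2 = (D - r + 1)^2 + 4 r (D + 1) >= 4 r D]. *)
have rn4 : 4 * r <= n.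
  have hd0 : 0 < d.+1%:R :> R by lra.
  rewrite -(ler_pM2l hd0); apply: le_trans rn.
  have := sqr_ge0 (d.+1%:R - r + 1); rewrite !expr2; nra.
have s0 : 0 < s%:R :> R by rewrite ltr0n muln_gt0.
(* The largest [L] with [s L + 1 <= n]: the bump has degree at most [n], and maximality keeps [n]
   below a multiple of [2 L + 1]. *)
set L := Num.truncn ((n - 1) / s%:R).
have nL0 : 0 <= (n - 1) / s%:R by rewrite divr_ge0 //; lra.
have L1 : s%:R * L%:R <= n - 1 by rewrite mulrC -ler_pdivlMr // truncn_le.
have L2 : n - 1 < s%:R * (L%:R + 1).
  by rewrite mulrC -ltr_pdivrMr // natr1 truncnS_gt.
have nL : n <= 2 * s%:R * (2 * L + 1)%:R.
  have sL : 0 <= s%:R * L%:R :> R by rewrite mulr_ge0.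
  by rewrite natrD natrM; lra.
have Tn : ((s * L + 1) + rho)%:R <= 2 * n.
  by rewrite !natrD natrM; lra.
have Wr : Wnorm r delta f = (fine (Wnorm r delta f))%:E.
  rewrite fineK // ge0_fin_numE //; have [x xS] := @sphere_nonempty R d.+1.
  apply: (@le_trans _ _ (supnorm f + loc_err r delta f x)%E).
    by rewrite adde_ge0 ?supnorm_ge0 ?loc_err_ge0.
  by apply: ereal_sup_ubound; exists x.
have [Q hQ fQ] := approx d M L n delta f _ n8 delta0 hd (esym hM) nL Tn fc Wr.
set W := fine _ in Wr fQ.
have nr0 : 0 < n `^ r by rewrite powR_gt0.
have Em : (Ebest m f <= (C * W / n `^ r)%:E)%E.
  apply: ge_ereal_inf; exists (supnorm (fun x => f x - Q x)).
    (* The degree is at most [2 D n + 2 n + r + 1], where [D = d.+1]; as [4 r <= n], it stays below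
       [2 (D + 2) n]. *)
    exists Q => //; apply: polyfun_of_poly_le hQ.
    rewrite -/s (_ : _%:R = 2 * M%:R + 2 * (s%:R * L%:R + 1) + rho%:R).
      by rewrite -hM /m; lra.
    by rewrite /s !(natrD, natrM); ring.
  apply: ge_ereal_sup => _ [x xS <-]; rewrite lee_fin ler_pdivlMr //.
  exact: fQ.
apply: (le_trans Em); rewrite Wr -EFinM lee_fin.
have k0 : 0 < k%:R :> R by rewrite ltr0n (dim_Pi_gt0 m0 hk).
have kr0 : 0 < k%:R `^ (r / d.+1%:R) by rewrite powR_gt0.
(* As [m = 2 (D + 2) n <= (4 n - 1) D] for [D = d.+1 >= 3], the dimension bound gives
   [k <= (32 n)^D]. *)
have kr : k%:R `^ (r / d.+1%:R) <= 32 `^ r * n `^ r.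
  rewrite -powRM ?(ltW n0) //.
  have -> : (32 * n) `^ r = ((32 * n) ^+ d.+1) `^ (r / d.+1%:R).
    rewrite -powR_mulrn ?mulr_ge0 ?(ltW n0) // -powRrM.
    by congr (_ `^ _); field; rewrite gt_eqF //; lra.
  apply: ge0_ler_powR; rewrite ?nnegrE ?exprn_ge0 ?mulr_ge0 ?(ltW n0) ?(ltW k0) ?(ltW r0) //.
  apply: (le_trans (dim_Pi_le m0 hk)).
  apply: lerXn2r; rewrite ?nnegrE ?mulr_ge0 ?addr_ge0 ?divr_ge0 ?(ltW m0) ?(ltW n0) //.
  rewrite (_ : 32 * n = 8 * (4 * n)); last ring.
  rewrite ler_pM2l // -lerBrDl ler_pdivrMr; last lra.
  by rewrite /m; nra.
(* This relaxes the bound just obtained to the stated one. *)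
have d6 : 1 <= d.+1%:R `^ 6^-1 :> R.
  rewrite -[leLHS](_ : d.+1%:R `^ 0 = 1); last by rewrite powRr0.
  by apply: ler_powR; lra.
have W0 : 0 <= W by rewrite fine_ge0 // Wr lee_fin; have [] := Wnorm_bounds (ltn0Sn d) delta0 Wr.
rewrite -[leLHS]mulrA [W / _]mulrC mulrA; apply: ler_wpM2r => //.
rewrite ler_pdivrMr // mulrAC ler_pdivlMr // -!mulrA ler_pM2l //.
apply: (le_trans kr); rewrite ler_pM2l ?powR_gt0 //.
by rewrite -[leLHS]mul1r ler_pM2r.
Qed.
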